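(* Let $A=[a_{ij}]\in\mathbb{R}^{n\times n}$ be a nonnegative, irreducible, diagonally symmetrizable matrix with null diagonal, let $\delta_i=\sum_{j=1}^n a_{ij}$, $\Delta=\mathrm{diag}\{\delta_1,\dots,\delta_n\}$, $H_1=\Delta^{-1}A$ and $L_1=I-H_1$. Let $\pi>0$ be a scalar parameter and consider the system $$\dot x=\Delta\left[-x+\pi H_1\psi(x)\right],\qquad x\in\mathbb{R}^n,$$ where $\psi(x)=[\psi_1(x_1)\,\cdots\,\psi_n(x_n)]^T$ and each $\psi_i:\mathbb{R}\to\mathbb{R}$ satisfies the properties (A.1)–(A.4) listed in the context. Let $\lambda_{n-1}(H_1)$ be the second largest eigenvalue of $H_1$ and let $\lambda_2(L_1)=1-\lambda_{n-1}(H_1)$ be the algebraic connectivity of $L_1$. The range of values of $\pi$ for which no extra equilibrium of the system (other than $0$, $x^+$ and $x^-$) can appear is given by $(1,\pi_2)$, with $$\pi_2=\frac{1}{\lambda_{n-1}(H_1)}>1,$$ and hence it is determined by the algebraic connectivity $\lambda_2(L_1)$.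
   Context: A matrix $A\in\mathbb{R}^{n\times n}$ is (diagonally) symmetrizable if $DA$ is symmetric for some diagonal matrix $D$ with positive diagonal entries; such a matrix has real eigenvalues. The matrix $H_1$ is symmetrizable, with real eigenvalues arranged in nondecreasing order $\lambda_1(H_1)\le\dots\le\lambda_{n-1}(H_1)\le\lambda_n(H_1)=\rho(H_1)=1$, where $\rho$ is the spectral radius. The least eigenvalue of the Laplacian $L_1$ is $\lambda_1(L_1)=1-\rho(H_1)=0$, and its second leftmost eigenvalue $\lambda_2(L_1)$ is called the algebraic connectivity of $L_1$. Properties of each $\psi_i$: (A.1) $\psi_i(x_i)=-\psi_i(-x_i)$ for all $x_i\in\mathbb{R}$ (odd); (A.2) $\frac{\partial\psi_i}{\partial x_i}(x_i)>0$ for all $x_i\in\mathbb{R}$ and $\frac{\partial\psi_i}{\partial x_i}(0)=1$ (monotone); (A.3) $\lim_{x_i\to\pm\infty}\psi_i(x_i)=\pm1$ (saturated); (A.4) $\psi_i$ is strictly convex for $x_i<0$ and strictly concave for $x_i>0$ (sigmoidal). The origin is always an equilibrium of the system. For $\pi<1$ it is the only one. At $\pi=1$ a pitchfork bifurcation occurs, and for all $\pi>1$ there are two further equilibria, $x^+$ in the nonnegative orthant $\mathbb{R}^n_+$ and $x^-$ in the nonpositive orthant $\mathbb{R}^n_-$, each locally asymptotically stable.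
   Formalization: When λ_{n-1}(H_1) ≤ 0 (e.g. complete graphs, stars), where 1/λ_{n-1}(H_1) > 1 fails, π_2 is read as +∞; the endpoint π = π_2, where in fact no extra equilibrium exists, is excluded from the claim that the range is (1, π_2). *)

(* Defs.v *)
(* MathComp + MathComp-Analysis, over an arbitrary R : realType. *)
From HB Require Import structures.
From mathcomp Require Import all_boot all_order all_fingroup all_algebra.
From mathcomp Require Import all_classical all_reals all_analysis.

Set Implicit Arguments.
Unset Strict Implicit.
Unset Printing Implicit Defensive.

Import Order.TTheory GRing.Theory Num.Theory.
Import numFieldNormedType.Exports.

Local Open Scope classical_set_scope.
Local Open Scope ring_scope.

Section Matrices.
Context {R : realType} {n : nat}.
Implicit Type A : 'M[R]_n.

(* A simultaneous permutation s of the rows and columns of A yields a block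
   upper triangular matrix with diagonal blocks of sizes k and n - k. *)
Definition reducible_mx A : Prop :=
  exists (s : 'S_n) (k : nat), (0 < k < n)%N /\
    forall i j : 'I_n, (k <= i)%N -> (j < k)%N -> A (s i) (s j) = 0.

Definition irreducible_mx A : Prop := ~ reducible_mx A.

Definition diag_symmetrizable A : Prop :=
  exists d : 'rV[R]_n, (forall i, 0 < d 0 i) /\
    (diag_mx d *m A)^T = diag_mx d *m A.

(* The eigenvalues of a matrix whose characteristic polynomial splits over R,
   with algebraic multiplicity, in nondecreasing order (the empty sequence if
   it does not split). *)
Definition eigenvalues A : seq R :=
  sort <=%R
    (xget [::] [set s : seq R | char_poly A = \prod_(x <- s) ('X - x%:P)]).

(* The index k is 1-based: lambda_ 1 A is the least eigenvalue of A and
   lambda_ n A the largest. *)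
Definition lambda_ (k : nat) A : R := (eigenvalues A)`_k.-1.

Definition Delta A : 'M[R]_n := diag_mx (\row_i \sum_j A i j).

Definition H1 A : 'M[R]_n := invmx (Delta A) *m A.

Definition L1 A : 'M[R]_n := 1%:M - H1 A.

End Matrices.

Section Sigmoids.
Context {R : realType}.
Implicit Type f : R -> R.

Definition strictly_convex_on (D : set R) f : Prop :=
  forall x y t : R, D x -> D y -> x != y -> 0 < t < 1 ->
    f (t * x + (1 - t) * y) < t * f x + (1 - t) * f y.

Definition strictly_concave_on (D : set R) f : Prop :=
  strictly_convex_on D (fun x => - f x).

Definition odd_fun f : Prop := forall x : R, f x = - f (- x).

Definition monotone_fun f : Prop :=
  (forall x : R, derivable f x 1 /\ 0 < derive1 f x) /\ derive1 f 0 = 1.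

Definition saturated f : Prop :=
  (f x @[x --> +oo] --> (1 : R)) /\ (f x @[x --> -oo] --> (-1 : R)).

Definition sigmoidal f : Prop :=
  strictly_convex_on [set x | x < 0] f /\
  strictly_concave_on [set x | 0 < x] f.

End Sigmoids.

Section System.
Context {R : realType} {n : nat}.
Variables (A : 'M[R]_n) (psi : 'I_n -> R -> R).
Implicit Type x : 'cV[R]_n.

Definition psi_vec x : 'cV[R]_n := \col_i psi i (x i 0).

(* The right-hand side of the differential equation x' = vector_field p x;
   the scalar p is the parameter usually written pi. *)
Definition vector_field (p : R) x : 'cV[R]_n :=
  Delta A *m (- x + p *: (H1 A *m psi_vec x)).

Definition equilibrium (p : R) x : Prop := vector_field p x = 0.

Definition nonneg_equilibrium (p : R) x : Prop :=
  [/\ equilibrium p x, x != 0 & forall i, 0 <= x i 0].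

Definition nonpos_equilibrium (p : R) x : Prop :=
  [/\ equilibrium p x, x != 0 & forall i, x i 0 <= 0].

Definition no_extra_equilibrium (p : R) : Prop :=
  exists xp xm : 'cV[R]_n,
    [/\ nonneg_equilibrium p xp, nonpos_equilibrium p xm &
        forall x, equilibrium p x -> [\/ x = 0, x = xp | x = xm]].

End System.

(* The parameter value p at which p * l reaches 1 as p increases from 0; it is
   never reached when l <= 0 (complete graphs and stars have
   lambda_ n.-1 (H1 A) <= 0). *)
Definition threshold {R : realType} (l : R) : \bar R :=
  if 0 < l then (1 / l)%:E else +oo%E.

(* Main.v *)
Require Import Defs.
From HB Require Import structures.
From mathcomp Require Import all_boot all_order all_fingroup all_algebra.
From mathcomp Require Import all_classical all_reals all_analysis.
From mathcomp Require Import lra ring.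

Set Implicit Arguments.
Unset Strict Implicit.
Unset Printing Implicit Defensive.

Import Order.TTheory GRing.Theory Num.Theory.
Import numFieldNormedType.Exports.

Local Open Scope classical_set_scope.
Local Open Scope ring_scope.

(* If D A is symmetric, put S = D A and m_i = sum_j S_ij; equilibria are the
   solutions of m_i x_i = p sum_j S_ij psi_j(x_j), and H_1 = M^-1 S, with
   M = diag m, has an M-orthonormal eigenbasis whose first vector is constant.

   For p <= 1 the maximum norm forces x = 0. For p > 1 a positive equilibrium
   exists by Knaster-Tarski and is unique because psi_j(t x) > t psi_j(x) for
   0 < t < 1. If x is an equilibrium changing sign, then on the span of the
   positive and negative parts of psi(x) the form p S exceeds M; that plane
   contains a vector M-orthogonal to the constants, so p lambda_{n-1} > 1.

   Let conversely p lambda_{n-1} > 1 and suppose that 0, a and -a are the only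
   equilibria. With y = psi(x), the energy
     E(x) = sum_i m_i (x_i y_i - int_0^{x_i} psi_i) - p/2 <y, S y>
   strictly decreases along the continuous odd map G that sends x to the
   solution x' of x' + p psi(x') = p (H_1 + 1) psi(x), except at equilibria.
   E is negative on a path joining a small constant vector to its opposite
   inside the plane spanned by the constants and the second eigenvector,
   punctured at 0. The iterates of G from each point of the path converge to a
   or to -a; the two basins are open, disjoint and exchanged by x |-> -x, which
   contradicts the connectedness of the path. *)

(** * Sigmoids *)

Section Sigmoid.
Context {R : realType} (f : R -> R).
Hypotheses (f_odd : odd_fun f) (f_mono : monotone_fun f).
Hypotheses (f_sat : saturated f) (f_sig : sigmoidal f).

Lemma sigmoid0 : f 0 = 0.
Proof. have := f_odd 0; rewrite oppr0; lra. Qed.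

Lemma sigmoidN x : f (- x) = - f x.
Proof. by rewrite [in RHS]f_odd opprK. Qed.

Lemma sigmoid_derivable x : derivable f x 1.
Proof. by have [/(_ x)[]] := f_mono. Qed.

Lemma sigmoid_continuous : continuous f.
Proof.
by move=> x; apply/differentiable_continuous/derivable1_diffP/sigmoid_derivable.
Qed.

Lemma sigmoid_homo : {homo f : x y / x < y}.
Proof.
move=> x y xy; apply: (@gtr0_derive1_lt_cc _ f x y) => //.
- by move=> z _; exact: sigmoid_derivable.
- by move=> z _; have [/(_ z)[]] := f_mono.
- exact/continuous_subspaceT/sigmoid_continuous.
- by rewrite in_itv/= lexx ltW.
- by rewrite in_itv/= lexx ltW.
Qed.

Lemma sigmoid_lt : {mono f : x y / x < y}.
Proof. exact: leW_mono (le_mono sigmoid_homo). Qed.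

Lemma sigmoid_le : {mono f : x y / x <= y}.
Proof. exact: le_mono sigmoid_homo. Qed.

Lemma sigmoid_gt0 x : (0 < f x) = (0 < x).
Proof. by rewrite -{1}sigmoid0 sigmoid_lt. Qed.

Lemma sigmoid_ge0 x : (0 <= f x) = (0 <= x).
Proof. by rewrite -{1}sigmoid0 sigmoid_le. Qed.

Lemma sigmoid_norm x : `|f x| = f `|x|.
Proof.
have [x0|x0] := leP 0 x; first by rewrite !ger0_norm ?sigmoid_ge0.
rewrite !ltr0_norm ?sigmoidN//.
by rewrite -sigmoid0 sigmoid_lt.
Qed.

Lemma sigmoid_le1 x : f x <= 1.
Proof.
rewrite leNgt; apply/negP => fx1.
have := f_sat.1 => /cvgr_lt/(_ _ fx1) [M [_ HM]].
have := HM (Num.max (M + 1) x).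
rewrite sigmoid_lt lt_max ltrDl ltr01/= => /(_ isT).
by rewrite ltNge le_max lexx orbT.
Qed.

Lemma sigmoid_norm_le1 x : `|f x| <= 1.
Proof. by rewrite sigmoid_norm sigmoid_le1. Qed.

(** Concavity is assumed only on the open half-line, so the chord from 0 is approached by chords
    from small [u > 0], using continuity at [t * x] and [f u >= 0]. *)
Lemma sigmoid_scale_le t x : 0 < t < 1 -> 0 < x -> t * f x <= f (t * x).
Proof.
move=> /andP[t0 t1] x0; rewrite leNgt; apply/negP => ftx.
pose g u := f (t * x + (1 - t) * u).
have gc : g u @[u --> 0] --> g 0.
  apply: (@cvg_comp _ _ _ (fun u => t * x + (1 - t) * u) f).
    by apply: cvgD; [exact: cvg_cst|apply: cvgM; [exact: cvg_cst|exact: cvg_id]].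
  exact: sigmoid_continuous.
have g0 : g 0 < t * f x by rewrite /g mulr0 addr0.
move/cvgr_lt : gc => /(_ _ g0) [e /= e0 He].
have e20 : 0 < e / 2 by rewrite divr_gt0.
have := He (e / 2); rewrite /= sub0r normrN gtr0_norm// ltr_pdivrMr//.
rewrite ltr_pMr// ltr1n => /(_ isT); rewrite /g => H.
have [_ /(_ x (e / 2 * (x / (x + e))) t)] := f_sig.
move=> /(_ x0); rewrite /=.
have u0 : 0 < e / 2 * (x / (x + e)) by rewrite mulr_gt0 ?divr_gt0 ?addr_gt0.
have u1 : e / 2 * (x / (x + e)) < e / 2.
  by rewrite gtr_pMr// ltr_pdivrMr ?addr_gt0// mul1r ltrDl.
have ux : e / 2 * (x / (x + e)) < x.
  rewrite mulrCA gtr_pMr// ltr_pdivrMr ?addr_gt0//; lra.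
move=> /(_ u0); rewrite (gt_eqF ux) t0 t1 => /(_ isT isT).
set u := (e / 2 * _) in u0 u1 ux *.
have : f (t * x + (1 - t) * u) <= f (t * x + (1 - t) * (e / 2)).
  by rewrite sigmoid_le lerD2l ler_wpM2l// ?subr_ge0 ?ltW.
have : 0 <= (1 - t) * f u by rewrite mulr_ge0 ?subr_ge0 ?sigmoid_ge0 ?ltW.
lra.
Qed.

(** The weak inequality compares [t * x] with the midpoint of [t * x] and [x]; strict concavity at
    that midpoint makes the result strict. *)
Lemma sigmoid_scale t x : 0 < t < 1 -> 0 < x -> t * f x < f (t * x).
Proof.
move=> /andP[t0 t1] x0.
have h01 : 0 < (1 + t) / 2 < 1 by lra.
have h1t0 : 0 < 1 + t by lra.
have h1t : 1 + t != 0 by rewrite gt_eqF.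
have hsh : (t / ((1 + t) / 2)) * ((1 + t) / 2 * x) = t * x by field.
have tx0 : 0 < t * x by rewrite mulr_gt0.
have := @sigmoid_scale_le (t / ((1 + t) / 2)) ((1 + t) / 2 * x).
rewrite hsh ltr_pdivrMr ?divr_gt0//.
have -> : t < 1 * ((1 + t) / 2) by lra.
have m0 : 0 < (1 + t) / 2 * x by rewrite mulr_gt0//; lra.
move=> /(_ isT m0) H1.
have txx : t * x < x by rewrite gtr_pMl.
have [_ /(_ x (t * x) (1 / 2) x0 tx0)] := f_sig.
rewrite (gt_eqF txx) => /(_ isT); rewrite divr_gt0// => /=.
have -> : (1 / 2 : R) < 1 by lra.
move=> /(_ isT).
have -> : 1 / 2 * x + (1 - 1 / 2) * (t * x) = (1 + t) / 2 * x by field.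
set a := f ((1 + t) / 2 * x) in H1 *; set b := f (t * x) in H1 *; set c := f x.
move=> H2.
have : t / ((1 + t) / 2) * a * ((1 + t) / 2) <= b * ((1 + t) / 2).
  by rewrite ler_wpM2r//; lra.
have -> : t / ((1 + t) / 2) * a * ((1 + t) / 2) = t * a by field.
nra.
Qed.

Lemma sigmoid_near0 e : 0 < e ->
  exists2 d, 0 < d & forall x, `|x| <= d -> `|f x - x| <= e * `|x|.
Proof.
move=> e0; have [_ df1] := f_mono.
have /cvg_ex[l Hl] := @sigmoid_derivable 0.
have l1 : l = 1 by rewrite -df1 derive1E; exact/esym/cvg_lim.
move/cvgrPdist_le : Hl => /(_ _ e0) [d /= d0 Hd].
exists (d / 2); first by rewrite divr_gt0.
move=> x xd; have [->|x0] := eqVneq x 0; first by rewrite sigmoid0 subrr normr0 mulr0.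
have := Hd x; rewrite /= sub0r normrN => /(_ _ x0).
have -> : `|x| < d by rewrite (le_lt_trans xd)// ltr_pdivrMr// ltr_pMr// ltr1n.
move=> /(_ isT); rewrite l1 addr0 sigmoid0 subr0 /GRing.scale/= mulr1.
rewrite -(ler_pM2r (_ : 0 < `|x|)) ?normr_gt0// -normrM mulrBl mul1r.
by rewrite mulrAC mulVf// mul1r distrC.
Qed.

(** By concavity [f z / z] cannot increase with [z], and it tends to 1 at 0, hence [f y <= y].
    Halving gives strictness: f(x) < 2 f(x/2) <= x. *)
Lemma sigmoid_lt_id x : 0 < x -> f x < x.
Proof.
move=> x0; suff le_id y : 0 < y -> f y <= y.
  have := @sigmoid_scale (1/2) x; have := le_id (1/2 * x); rewrite pmulr_rgt0//.
  have -> : 0 < (1 / 2 : R) < 1 by lra.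
  by move=> /(_ x0) + /(_ isT x0); lra.
move=> {x x0} y0; rewrite leNgt; apply/negP => fy.
(* Half of the excess slope: near 0, f(z) <= (1 + e) z, while the chord to [y] forces f(z) >= (1 + 2
   e) z. *)
pose e := (f y / y - 1) / 2.
have e0 : 0 < e by rewrite divr_gt0// subr_gt0 ltr_pdivlMr// mul1r.
have [d d0 Hd] := sigmoid_near0 e0.
pose z := Num.min d (y / 2).
have z0 : 0 < z by rewrite lt_min d0 divr_gt0.
have zy : z < y by rewrite gt_min orbC ltr_pdivrMr// ltr_pMr// ltr1n.
have := Hd z; rewrite gtr0_norm// ge_min lexx => /(_ isT) /ler_normlP[_ H].
have := @sigmoid_scale_le (z / y) y; rewrite divfK ?gt_eqF//.
rewrite divr_gt0//= ltr_pdivrMr// mul1r => /(_ zy y0).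
have E : z / y * f y = z * (1 + 2 * e) by rewrite /e; field; rewrite gt_eqF.
rewrite E; nra.
Qed.

Lemma sigmoid_norm_lt x : x != 0 -> `|f x| < `|x|.
Proof. by move=> x0; rewrite sigmoid_norm sigmoid_lt_id// normr_gt0. Qed.

Lemma sigmoid_norm_le x : `|f x| <= `|x|.
Proof.
have [->|/sigmoid_norm_lt/ltW//] := eqVneq x 0.
by rewrite sigmoid0 normr0.
Qed.

Lemma sigmoid_primitive : exists F : R -> R,
  [/\ forall x, F (- x) = F x, F 0 = 0,
      forall x y, f x * (y - x) <= F y - F x &
      forall c d, (forall x, 0 <= x <= d -> c * x <= f x) ->
        forall x, `|x| <= d -> c * x ^+ 2 / 2 <= F x].
Proof.
(* Integrating from -1 makes 0 an interior point for the fundamental theorem of calculus; negative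
   arguments are then handled by parity. *)
pose G x := (\int[@lebesgue_measure R]_(t in [set` `[-1, x]]) f t)%R.
have dG x : -1 < x -> derivable G x 1 /\ derive1 G x = f x.
  move=> x1; apply: (@continuous_FTC1_closed _ f (-1) x (x + 1)) => //.
  - by rewrite ltrDl.
  - apply: continuous_compact_integrable; first exact: segment_compact.
    exact/continuous_subspaceT/sigmoid_continuous.
  - exact: sigmoid_continuous.
have mvt (h h' : R -> R) (a b : R) : 0 <= a -> a <= b ->
    (forall x : R, -1 < x -> is_derive x 1 h (h' x)) ->
    exists2 c, a <= c <= b & h b - h a = h' c * (b - a).
  move=> a0 ab dh; have [||c] := @MVT_segment R h h' a b ab.
  - by move=> x; rewrite in_itv/= => /andP[ax _]; apply: dh; lra.
  - apply: continuous_in_subspaceT => x; rewrite inE/= in_itv/= => /andP[ax _].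
    apply/differentiable_continuous/derivable1_diffP.
    by have /dh[] : -1 < x by lra.
  - by rewrite in_itv/= => cab E; exists c.
have idG (x : R) : -1 < x -> is_derive x 1 G (f x).
  by move=> /dG[? <-]; rewrite derive1E; apply: DeriveDef.
pose F (x : R) := G `|x| - G 0.
have F0 : F 0 = 0 by rewrite /F normr0 subrr.
have FN x : F (- x) = F x by rewrite /F normrN.
have Fpos x y : 0 <= x -> 0 <= y -> f x * (y - x) <= F y - F x.
  move=> x0 y0; have -> : F y - F x = G y - G x by rewrite /F !ger0_norm//; ring.
  have [xy|/ltW yx] := leP x y.
    have [c /andP[xc _] ->] := mvt G f x y x0 xy idG.
    by rewrite ler_wpM2r ?subr_ge0// sigmoid_le.
  have [c /andP[_ cx] E] := mvt G f y x y0 yx idG.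
  rewrite -lerN2 opprB E -mulrN opprB ler_wpM2r ?subr_ge0//.
  by rewrite sigmoid_le.
have Fpos' x y : 0 <= x -> f x * (y - x) <= F y - F x.
  move=> x0; have [y0|/ltW y0] := leP 0 y; first exact: Fpos.
  rewrite -FN; apply: le_trans (Fpos _ _ x0 _); last lra.
  by rewrite ler_wpM2l ?sigmoid_ge0//; lra.
exists F; split => //.
- move=> x y; have [x0|/ltW x0] := leP 0 x; first exact: Fpos'.
  by rewrite -(FN y) -(FN x); have := Fpos' (- x) (- y); rewrite sigmoidN; lra.
- move=> c d Hc x xd; suff : c * `|x| ^+ 2 / 2 <= F `|x|.
    by rewrite real_normK ?num_real// /F normr_id.
  move: `|x| (normr_ge0 x) xd => {}x x0 xd.
  pose h y := G y - c / 2 * y ^+ 2.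
  have dh (y : R) : -1 < y -> is_derive y 1 h (f y - c * y).
    move=> /idG dGy; rewrite /h.
    by apply: is_derive_eq; rewrite /GRing.scale/=; field.
  have [z /andP[z0 zx]] := mvt h _ 0 x (lexx _) x0 dh.
  rewrite /h /F subr0 expr0n mulr0 subr0 (ger0_norm x0) => E.
  have : 0 <= (f z - c * z) * x by rewrite mulr_ge0// subr_ge0 Hc// z0 (le_trans zx).
  by rewrite -E; lra.
Qed.

End Sigmoid.

(** * Eigenvalues and the weighted spectral theorem *)

Section Eigenvalues.
Context {R : realType} {n : nat}.
Implicit Types (A : 'M[R]_n) (s : seq R).

(** [xget] picks an arbitrary list of roots; two such lists are permutations of each other, and
    sorting removes the ambiguity. *)
Lemma eigenvaluesE A s :
  char_poly A = \prod_(x <- s) ('X - x%:P) -> eigenvalues A = sort <=%R s.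
Proof.
move=> As; apply/perm_sort_leP.
set P := [set s : seq R | _]; have Ps : P s by [].
have := @xgetI _ [::] P s Ps; rewrite /P/= As => E.
by apply: prod_XsubC_eq; exact/esym.
Qed.

Lemma char_poly_similar (U V D H : 'M[R]_n) :
  U *m V = 1%:M -> U *m H = D *m U -> char_poly H = char_poly D.
Proof.
move=> UV UH.
have E : map_mx polyC U *m char_poly_mx H = char_poly_mx D *m map_mx polyC U.
  rewrite /char_poly_mx mulmxBr mulmxBl -!map_mxM/= UH; congr (_ - _).
  by rewrite scalar_mxC.
have dU : \det (map_mx polyC U) != 0 :> {poly R}.
  rewrite det_map_mx/= polyC_eq0 -unitfE.
  by have /mulmx1_unit[] := UV.
by apply: (mulfI dU); rewrite /char_poly -det_mulmx E det_mulmx mulrC.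
Qed.

Lemma char_poly_diag (d : 'rV[R]_n) :
  char_poly (diag_mx d) = \prod_(x <- [seq d 0 i | i <- enum 'I_n]) ('X - x%:P).
Proof.
rewrite char_poly_trig ?diag_mx_is_trig// big_map big_enum/=.
by apply: eq_bigr => i _; rewrite mxE eqxx.
Qed.

Lemma sort_le_rev s : sort <=%R (map (fun x => 1 - x) s) =
  rev (map (fun x => 1 - x) (sort <=%R s)).
Proof.
apply: (@le_sorted_eq _ R); first exact: sort_le_sorted.
- rewrite rev_sorted sorted_map; apply: sub_sorted (sort_le_sorted s) => x y /=.
  by rewrite lerD2l lerN2.
- rewrite perm_sort perm_sym perm_rev; apply: perm_map.
  by rewrite perm_sort.
Qed.

End Eigenvalues.

(** * Spectral theorem for a symmetric form relative to a positive diagonal form *)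

Section BilinearForm.
Context {R : realType} {n : nat}.
Implicit Types (S : 'M[R]_n) (x y z : 'rV[R]_n) (m : 'rV[R]_n).

Definition bform S x y : R := (x *m S *m y^T) 0 0.

Lemma bformE S x y : bform S x y = \sum_i \sum_j S i j * x 0 i * y 0 j.
Proof.
rewrite /bform mxE exchange_big/=; apply: eq_bigr => j _.
rewrite mxE mulr_suml; apply: eq_bigr => i _; rewrite !mxE.
by rewrite [x 0 i * _]mulrC.
Qed.

Lemma bformDl S x y z : bform S (x + y) z = bform S x z + bform S y z.
Proof. by rewrite /bform !mulmxDl mxE. Qed.

Lemma bformDr S x y z : bform S x (y + z) = bform S x y + bform S x z.
Proof. by rewrite /bform linearD/= mulmxDr mxE. Qed.

Lemma bformZl S a x y : bform S (a *: x) y = a * bform S x y.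
Proof. by rewrite /bform -!scalemxAl mxE. Qed.

Lemma bformZr S a x y : bform S x (a *: y) = a * bform S x y.
Proof. by rewrite /bform linearZ/= -scalemxAr mxE. Qed.

Lemma bformC S x y : S^T = S -> bform S x y = bform S y x.
Proof.
move=> ST; rewrite !bformE exchange_big/=; apply: eq_bigr => i _.
apply: eq_bigr => j _; have -> : S j i = S i j by rewrite -[in RHS]ST mxE.
by rewrite mulrAC.
Qed.

Lemma bform_diag m x y : bform (diag_mx m) x y = \sum_i m 0 i * x 0 i * y 0 i.
Proof.
rewrite /bform mxE; apply: eq_bigr => i _.
by rewrite mul_mx_diag !mxE [x 0 i * _]mulrC.
Qed.

Lemma continuous_bform S (f g : 'rV[R]_n -> 'rV[R]_n) :
  continuous f -> continuous g -> continuous (fun x => bform S (f x) (g x)).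
Proof.
move=> cf cg; under [X in continuous X]funext do rewrite bformE.
apply: continuous_big => [|i _]; first exact: add_continuous.
apply: continuous_big => [|j _]; first exact: add_continuous.
have cc h k : continuous h -> continuous (fun x : 'rV[R]_n => (h x : 'rV[R]_n) 0 k).
  by move=> ch x; apply: (continuous_comp (f := h) (g := fun M => M 0 k));
    [exact: ch|exact: coord_continuous].
move=> x; have cSf := continuousM (@cst_continuous _ _ (S i j) x) (cc _ i cf x).
exact: (continuousM cSf (cc _ j cg x)).
Qed.

(** The first-order optimality condition at a maximum, without derivatives. The test value divides
    by [k + 1] to cover [k = 0]. *)
Lemma quad_ge0_eq0 (c k : R) : (forall t, t * c <= t ^+ 2 * k) -> c = 0.
Proof.
move=> H; have k0 : 0 <= k.
  by have := H 1; have := H (-1); rewrite mulN1r mul1r sqrrN expr1n mul1r; lra.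
have := H (c / (k + 1)); set t := c / (k + 1).
have k1 : k + 1 != 0 by rewrite gt_eqF// ltr_wpDl.
have ct : c = t * (k + 1) by rewrite divfK.
rewrite ct => h; have : t ^+ 2 <= 0 by nra.
by rewrite le_eqVlt ltNge sqr_ge0 orbF sqrf_eq0 => /eqP ->; rewrite mul0r.
Qed.

Variables (S : 'M[R]_n) (m : 'rV[R]_n).
Hypotheses (ST : S^T = S) (m_gt0 : forall i, 0 < m 0 i).
Let dot := bform (diag_mx m).

Lemma dot_term_ge0 x i : 0 <= m 0 i * x 0 i * x 0 i.
Proof. by rewrite -mulrA -expr2 mulr_ge0 ?sqr_ge0// ltW. Qed.

Lemma dot_ge0 x : 0 <= dot x x.
Proof.
rewrite /dot bform_diag; apply: sumr_ge0 => i _; exact: dot_term_ge0.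
Qed.

Lemma dot_eq0 x : (dot x x == 0) = (x == 0).
Proof.
apply/eqP/eqP => [|->]; last by rewrite /dot /bform !mul0mx mxE.
rewrite /dot bform_diag => /eqP; rewrite psumr_eq0 => [/allP x0|i _]; last first.
  exact: dot_term_ge0.
apply/rowP => i; rewrite !mxE; have := x0 i; rewrite mem_index_enum => /(_ isT)/=.
by rewrite !mulf_eq0 (gt_eqF (m_gt0 i))/= orbb => /eqP.
Qed.

Lemma dot_gt0 x : (0 < dot x x) = (x != 0).
Proof. by rewrite lt_def dot_eq0 dot_ge0 andbT. Qed.

Lemma dotC x y : dot x y = dot y x.
Proof. by apply: bformC; rewrite tr_diag_mx. Qed.

(** Provides the maximizer of the Rayleigh quotient. Boundedness follows from m_i x_i^2 <= 1 and
    |x_i| <= 1 + x_i^2. *)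
Lemma compact_sphere (k : nat) (e : nat -> 'rV[R]_n) :
  compact [set x | dot x x = 1 /\ forall i, (i < k)%N -> dot x (e i) = 0].
Proof.
apply: bounded_closed_compact.
  exists (\sum_i (1 + (m 0 i)^-1)); split; first exact: num_real.
  move=> M hM x [/= x1 _]; rewrite -[leLHS]/(mx_norm x) mx_normrE.
  apply/bigmax_leP; split.
    apply: le_trans (ltW hM); apply: sumr_ge0 => i _.
    by rewrite addr_ge0 ?invr_ge0// ltW.
  move=> [j i] _ /=; rewrite ord1; apply: le_trans (ltW hM).
  have : m 0 i * x 0 i * x 0 i <= 1.
    rewrite -x1 /dot bform_diag (bigD1 i)//= lerDl.
    by apply: sumr_ge0 => l _; exact: dot_term_ge0.
  rewrite -mulrA -ler_pdivlMl// mulr1 -expr2 -real_normK ?num_real// => xi.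
  apply: (@le_trans _ _ (1 + (m 0 i)^-1)).
    have := sqr_ge0 (`|x 0 i| - 1); have := normr_ge0 (x 0 i); nra.
  rewrite (bigD1 i)//= lerDl; apply: sumr_ge0 => l _.
  by rewrite addr_ge0 ?invr_ge0// ltW.
rewrite (_ : mkset _ = [set x | dot x x = 1] `&`
   \bigcap_(i in [set i | (i < k)%N]) [set x | dot x (e i) = 0]); last first.
  by apply/seteqP; split => x /= [? h]; split.
apply: closedI.
  apply: (@closed_comp _ _ (fun x => dot x x) [set 1]); last exact: closed_eq.
  by move=> x _; apply: continuous_bform => y; exact: cvg_id.
apply: closed_bigI => i _.
apply: (@closed_comp _ _ (fun x => dot x (e i)) [set 0]); last exact: closed_eq.
by move=> x _; apply: continuous_bform => y; [exact: cvg_id|exact: cst_continuous].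
Qed.

Lemma exists_orthogonal (k : nat) (e : nat -> 'rV[R]_n) : (k < n)%N ->
  exists2 x, dot x x = 1 & forall i, (i < k)%N -> dot x (e i) = 0.
Proof.
move=> kn; pose E := \matrix_(j < n, i < k) (m 0 j * e i 0 j).
have : kermx E != 0.
  rewrite kermx_eq0 /row_free ltn_eqF//.
  by apply: leq_ltn_trans kn; exact: rank_leq_col.
case/rowV0Pn => v /sub_kermxP vE v0.
have dv : 0 < dot v v by rewrite dot_gt0.
exists ((Num.sqrt (dot v v))^-1 *: v).
  rewrite /dot bformZl bformZr mulrA -invfM -expr2 sqr_sqrtr ?ltW//.
  by rewrite mulVf// gt_eqF.
move=> i ik; rewrite /dot bformZl; suff -> : bform (diag_mx m) v (e i) = 0.
  by rewrite mulr0.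
have /matrixP/(_ 0 (Ordinal ik)) := vE; rewrite !mxE => E0.
rewrite bform_diag -[RHS]E0; apply: eq_bigr => j _.
by rewrite !mxE/= mulrA [v 0 j * _]mulrC.
Qed.

(* The next eigenvector maximizes the Rayleigh quotient on the orthogonal
   complement of the previous ones. *)
Lemma next_eigenvector (k : nat) (e : nat -> 'rV[R]_n) (l : nat -> R) :
  (k < n)%N ->
  (forall i, (i < k)%N -> e i *m S = l i *: (e i *m diag_mx m)) ->
  exists u a, [/\ dot u u = 1, forall i, (i < k)%N -> dot u (e i) = 0 &
    u *m S = a *: (u *m diag_mx m)].
Proof.
move=> kn eS; have [x0 x01 x0e] := exists_orthogonal e kn.
have [||u +] := @compact_EVT_max _ _ (fun x => bform S x x) _ _
    (@compact_sphere k e); first by exists x0.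
  apply: continuous_subspaceT; apply: continuous_bform => y; exact: cvg_id.
rewrite inE/= => -[u1 ue] umax; pose a := bform S u u.
have le_a x : (forall i, (i < k)%N -> dot x (e i) = 0) ->
    bform S x x <= a * dot x x.
  move=> xe; have [->|xn0] := eqVneq x 0.
    by rewrite /dot /bform !mul0mx !mxE mulr0.
  have dx : 0 < dot x x by rewrite dot_gt0.
  pose q := Num.sqrt (dot x x).
  have q0 : 0 < q by rewrite sqrtr_gt0.
  have qq : dot x x = q * q by rewrite -expr2 sqr_sqrtr ?ltW.
  have := umax (q^-1 *: x); rewrite inE/= /dot !bformZl !bformZr -!/dot qq.
  rewrite mulKf ?gt_eqF// mulVf ?gt_eqF// !ler_pdivrMl//.
  rewrite (_ : a * (q * q) = q * (q * bform S u u)); last by rewrite /a; ring.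
  apply; split=> // i /xe; by rewrite /dot bformZl => ->; rewrite mulr0.
exists u, a; split=> //.
(* The residual of the eigenvalue equation; the first-order condition at the maximizer makes it
   vanish on the orthogonal complement of the [e i]. *)
pose r := u *m S - a *: (u *m diag_mx m).
have rE x : (r *m x^T) 0 0 = bform S u x - a * dot u x.
  rewrite mulmxBl -scalemxAl /dot /bform.
  by rewrite [LHS]mxE [X in _ + X]mxE [X in _ - X]mxE.
have r_orth x : (forall i, (i < k)%N -> dot x (e i) = 0) -> (r *m x^T) 0 0 = 0.
  move=> xe; rewrite rE.
  suff /quad_ge0_eq0 : forall t, t * (2 * (bform S u x - a * dot u x)) <=
      t ^+ 2 * (a * dot x x - bform S x x) by lra.
  move=> t; have ut i : (i < k)%N -> dot (u + t *: x) (e i) = 0.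
    by move=> ik; rewrite /dot bformDl bformZl -!/dot ue// xe// mulr0 addr0.
  have := le_a _ ut; rewrite /dot.
  rewrite !(bformDl, bformDr, bformZl, bformZr) -!/dot.
  by rewrite [bform S x u]bformC// [dot x u]dotC u1 -/a; nra.
(* [z] represents [r] in the weighted inner product; it is orthogonal to the [e i], hence to
   itself. *)
pose z := \row_i (r 0 i / m 0 i).
have dz y : dot z y = (r *m y^T) 0 0.
  rewrite /dot bform_diag mxE; apply: eq_bigr => i _; rewrite !mxE.
  by rewrite [m 0 i * _]mulrC divfK// gt_eqF.
have /r_orth : forall i, (i < k)%N -> dot z (e i) = 0.
  move=> i ik; rewrite dz rE bformC// {1}/bform eS// -scalemxAl mxE.
  by rewrite -/(bform _ _ _) -/dot dotC ue// !mulr0 subrr.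
rewrite -dz => /eqP; rewrite dot_eq0 => /eqP z0.
apply/eqP; rewrite -subr_eq0 -/r; apply/eqP/rowP => i.
have /rowP/(_ i) := z0; rewrite !mxE => /eqP.
by rewrite mulf_eq0 invr_eq0 (gt_eqF (m_gt0 i)) orbF => /eqP.
Qed.

Lemma partial_eigenbasis (u1 : 'rV[R]_n) (l1 : R) (k : nat) : (k <= n)%N ->
  dot u1 u1 = 1 -> u1 *m S = l1 *: (u1 *m diag_mx m) ->
  exists (e : nat -> 'rV[R]_n) (l : nat -> R),
    [/\ e 0%N = u1, l 0%N = l1,
      forall i j, (i < k)%N -> (j < k)%N -> dot (e i) (e j) = (i == j)%:R &
      forall i, (i < k)%N -> e i *m S = l i *: (e i *m diag_mx m)].
Proof.
move=> kn u11 u1S; elim: k kn => [_|k IH kn].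
  by exists (fun=> u1), (fun=> l1).
have [e [l [e0 l0 ee eS]]] := IH (ltnW kn).
(* The last conjunct imposes the prescribed [u1] and [l1], instead of a maximizer, at index 0. *)
have [u [a [uu ue uS]]] : exists u a, [/\ dot u u = 1,
    forall i, (i < k)%N -> dot u (e i) = 0,
    u *m S = a *: (u *m diag_mx m) & k = 0%N -> u = u1 /\ a = l1].
  case: k IH kn e0 l0 ee eS => [|k] IH kn e0 l0 ee eS; first by exists u1, l1.
  by have [u [a [? ? ?]]] := next_eigenvector kn eS; exists u, a.
move=> u0; exists (fun i => if i == k then u else e i).
exists (fun i => if i == k then a else l i); split.
- by case: eqP => // /esym /u0 [].
- by case: eqP => // /esym /u0 [].
- move=> i j; rewrite !ltnS [(i <= k)%N]leq_eqVlt [(j <= k)%N]leq_eqVlt.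
  case: eqP => [->|ik]/=; case: eqP => [->|jk]//=; rewrite ?eqxx//.
  + by move=> _ /ue ->; rewrite eq_sym (introF eqP jk).
  + by move=> /ue; rewrite dotC => -> _; rewrite (introF eqP ik).
  + exact: ee.
- move=> i; rewrite ltnS leq_eqVlt; case: eqP => //= _; exact: eS.
Qed.

(** With the [e i] as rows of U, orthonormality reads U M U^T = 1, and M H = S gives (U M) H = D (U
    M): the characteristic polynomial of [H] splits with roots [l i]. The last clause is Parseval's
    identity with its analogue for [S]. *)
Lemma eigenbasis (H : 'M[R]_n) (u1 : 'rV[R]_n) (l1 : R) :
  diag_mx m *m H = S -> dot u1 u1 = 1 -> u1 *m S = l1 *: (u1 *m diag_mx m) ->
  exists (e : nat -> 'rV[R]_n) (l : nat -> R),
    [/\ e 0%N = u1 /\ l 0%N = l1,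
      forall i j, (i < n)%N -> (j < n)%N -> dot (e i) (e j) = (i == j)%:R,
      forall i, (i < n)%N -> e i *m S = l i *: (e i *m diag_mx m),
      eigenvalues H = sort <=%R [seq l i | i <- iota 0 n] /\
      eigenvalues (1%:M - H) = rev (map (fun a : R => 1 - a) (eigenvalues H)) &
      forall x, dot x x = \sum_(i < n) dot x (e i) ^+ 2 /\
        bform S x x = \sum_(i < n) l i * dot x (e i) ^+ 2].
Proof.
move=> MH u11 u1S; have [e [l [e0 l0 ee eS]]] := partial_eigenbasis (leqnn n) u11 u1S.
exists e, l; pose M := diag_mx m.
pose U : 'M[R]_n := \matrix_(i, j) e i 0 j; pose D := diag_mx (\row_(i < n) l i).
have rowU i : row i U = e i by apply/rowP => j; rewrite !mxE.
have UMU : U *m M *m U^T = 1%:M.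
  apply/matrixP => i j; rewrite mxE [RHS]mxE -[i == j]/(val i == val j).
  rewrite -(ee i j (ltn_ord i) (ltn_ord j)).
  rewrite /dot bform_diag; apply: eq_bigr => a _.
  by rewrite mul_mx_diag !mxE [e i 0 a * _]mulrC.
have US : U *m S = D *m U *m M.
  apply/row_matrixP => i; rewrite row_mul rowU eS// -mulmxA mul_diag_mx.
  apply/rowP => j; rewrite [LHS]mxE [RHS]mxE [RHS]mxE.
  by rewrite [(\row_(k < n) l k) 0 i]mxE -(rowU i) -row_mul mxE.
have UH : (U *m M) *m H = D *m (U *m M) by rewrite -mulmxA MH US mulmxA.
have lsE : [seq (\row_(i < n) l i) 0 i | i <- enum 'I_n] = [seq l i | i <- iota 0 n].
  rewrite -val_enum_ord -map_comp; apply: eq_map => i /=; by rewrite mxE.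
have cH : char_poly H = \prod_(x <- [seq l i | i <- iota 0 n]) ('X - x%:P).
  by rewrite (char_poly_similar UMU UH) char_poly_diag lsE.
have eH := eigenvaluesE cH.
split=> //.
  split=> //; rewrite eH -sort_le_rev; apply: eigenvaluesE.
  have UH1 : (U *m M) *m (1%:M - H) = diag_mx (\row_(i < n) (1 - l i)) *m (U *m M).
    rewrite mulmxBr mulmx1 UH -[X in X - _]mul1mx -mulmxBl; congr (_ *m _).
    by apply/matrixP => i j; rewrite !mxE; case: eqP => _; rewrite ?mulr1n ?mulr0n ?subrr.
  rewrite (char_poly_similar UMU UH1) char_poly_diag.
  suff -> : [seq (\row_(i < n) (1 - l i)) 0 i | i <- enum 'I_n] =
      map (fun a : R => 1 - a) [seq l i | i <- iota 0 n] by [].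
  by rewrite -val_enum_ord -2!map_comp; apply: eq_map => i /=; rewrite mxE.
move=> x; pose c := x *m M *m U^T.
have cE (i : 'I_n) : c 0 i = dot x (e i).
  rewrite /dot bform_diag /c mxE; apply: eq_bigr => j _.
  by rewrite mul_mx_diag !mxE [x 0 j * _]mulrC.
have xE : x = c *m U.
  have : (M *m U^T) *m U = 1%:M by apply: mulmx1C; rewrite mulmxA.
  by rewrite /c -!mulmxA => ->; rewrite mulmx1.
split.
  have -> : dot x x = (c *m c^T) 0 0.
    by rewrite /dot /bform {2}xE trmx_mul mulmxA.
  by rewrite mxE; apply: eq_bigr => i _; rewrite -cE [c^T _ _]mxE expr2.
have -> : bform S x x = (c *m D *m c^T) 0 0.
  rewrite /bform {1}xE -(mulmxA c) US {1}xE trmx_mul !mulmxA.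
  by rewrite -(mulmxA (c *m D) U M) -(mulmxA (c *m D) _ U^T) UMU mulmx1.
rewrite mxE; apply: eq_bigr => i _.
rewrite mul_mx_diag -cE [c^T _ _]mxE [X in X * _]mxE [(\row_(k < n) l k) _ _]mxE.
by rewrite expr2; ring.
Qed.

End BilinearForm.

(** * Equilibria of constant sign and of changing sign *)

(** The inverse of 1 plus the sum of the inverses works, and is positive even for an empty index
    set. *)
Lemma common_radius (R : realType) (n : nat) (d : 'I_n -> R) :
  (forall j, 0 < d j) -> exists2 e, 0 < e & forall j, e <= d j.
Proof.
move=> d0; exists (1 + \sum_j (d j)^-1)^-1.
  by rewrite invr_gt0 ltr_pwDl// sumr_ge0// => j _; rewrite invr_ge0 ltW.
move=> j; rewrite -[leRHS]invrK lef_pV2 ?posrE ?invr_gt0//; last first.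
  by rewrite ltr_pwDl// sumr_ge0// => i _; rewrite invr_ge0 ltW.
rewrite (bigD1 j)//= addrCA lerDl addr_ge0// sumr_ge0// => i _.
by rewrite invr_ge0 ltW.
Qed.

(** If no nonzero entry leads out of [I], listing the complement of [I] before [I] yields the zero
    block of [reducible_mx], with [k] the size of the complement. *)
Lemma irreducible_edge (R : realType) (n : nat) (A : 'M[R]_n) (I : {set 'I_n}) :
  irreducible_mx A -> I != finset.set0 -> I != finset.setT ->
  exists i j, [/\ i \in I, j \notin I & A i j != 0].
Proof.
move=> irrA I0 IT; apply: contrapT => noedge; apply: irrA.
have A0 i j : i \in I -> j \notin I -> A i j = 0.
  by move=> iI jI; apply/eqP; apply: contrapT => /negP Aij; apply: noedge; exists i, j.
pose t := enum (~: I)%SET ++ enum I.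
have t_mem i : i \in t by rewrite mem_cat !mem_enum inE orNb.
have t_uniq : uniq t.
  rewrite cat_uniq !enum_uniq andbT/=; apply/hasPn => i.
  by rewrite !mem_enum inE => ->.
have t_size : size t = n.
  by rewrite -[RHS](card_ord n) cardT; apply/perm_size/uniq_perm;
    rewrite ?enum_uniq// => i; rewrite t_mem mem_enum.
have [k0 _] := set0Pn _ I0.
pose s0 (k : 'I_n) := nth k0 t k.
have s0_inj : injective s0.
  move=> k l /eqP; rewrite /s0 nth_uniq ?t_size// => /eqP; exact: val_inj.
exists (perm s0_inj), (size (enum (~: I)%SET)); split.
  rewrite -cardE; apply/andP; split.
    rewrite card_gt0; apply: contra IT => /eqP E.
    by rewrite -(finset.setCK I) E finset.setC0.
  rewrite -[X in (_ < X)%N](card_ord n) -(cardsC I) addnC.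
  by rewrite -{1}[#|_|]addn0 ltn_add2l card_gt0.
move=> i j ki jk; rewrite !permE; apply: A0.
  rewrite /s0 nth_cat ltnNge ki/=; rewrite -mem_enum; apply: mem_nth.
  by rewrite ltn_subLR// -size_cat -/t t_size.
rewrite /s0 nth_cat jk; have := mem_nth k0 jk.
by rewrite mem_enum inE.
Qed.

Lemma sum_lt (R : realType) (n : nat) (F G : 'I_n -> R) (i : 'I_n) :
  (forall j, F j <= G j) -> F i < G i -> \sum_j F j < \sum_j G j.
Proof.
by move=> FG FGi; rewrite (bigD1 i)//= [ltRHS](bigD1 i)//= ltr_leD ?ler_sum.
Qed.

Lemma sum_gt0 (R : realType) (n : nat) (F : 'I_n -> R) (i : 'I_n) :
  (forall j, 0 <= F j) -> 0 < F i -> 0 < \sum_j F j.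
Proof. by move=> F0 Fi; rewrite (bigD1 i)//= ltr_pwDl ?sumr_ge0. Qed.

Section Network.
Context {R : realType} {n : nat}.
Variables (S : 'M[R]_n) (psi : 'I_n -> R -> R).
Let m : 'rV[R]_n := \row_i \sum_j S i j.
Hypotheses (ST : S^T = S) (S_ge0 : forall i j, 0 <= S i j).
Hypothesis m_gt0 : forall i, 0 < m 0 i.
Hypothesis S_edge : forall I : {set 'I_n}, I != finset.set0 -> I != finset.setT ->
  exists i j, [/\ i \in I, j \notin I & 0 < S i j].
Hypotheses (psi_odd : forall i, odd_fun (psi i))
  (psi_monotone : forall i, monotone_fun (psi i))
  (psi_saturated : forall i, saturated (psi i))
  (psi_sigmoidal : forall i, sigmoidal (psi i)).
Implicit Types x y : 'rV[R]_n.
Let dot := bform (diag_mx m).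
Let ones : 'rV[R]_n := const_mx 1.

Definition steady (p : R) x :=
  forall i, m 0 i * x 0 i = p * \sum_j S i j * psi j (x 0 j).

Lemma S_sym i j : S i j = S j i.
Proof. by rewrite -[in RHS]ST mxE. Qed.

Lemma sumS i a : \sum_j S i j * a = m 0 i * a.
Proof. by rewrite mxE mulr_suml. Qed.

Lemma wsum_le i (c d : 'I_n -> R) : (forall j, c j <= d j) ->
  \sum_j S i j * c j <= \sum_j S i j * d j.
Proof. by move=> cd; apply: ler_sum => j _; rewrite ler_wpM2l. Qed.

Lemma wsum_lt i (c d : 'I_n -> R) j : (forall j, c j <= d j) ->
  0 < S i j -> c j < d j -> \sum_j S i j * c j < \sum_j S i j * d j.
Proof.
move=> cd Sij cdj; apply: (@sum_lt _ _ _ _ j); last by rewrite ltr_pM2l.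
by move=> k; rewrite ler_wpM2l.
Qed.

Lemma exists_neighbor i : exists j, 0 < S i j.
Proof.
apply: contrapT => /forallNP noS; have := m_gt0 i.
rewrite mxE big1 ?ltxx// => j _; apply/eqP; rewrite eq_le S_ge0 andbT.
by rewrite leNgt; apply/negP.
Qed.

Lemma wsum_lt_all i (c d : 'I_n -> R) : (forall j, c j < d j) ->
  \sum_j S i j * c j < \sum_j S i j * d j.
Proof.
by move=> cd; have [j Sij] := exists_neighbor i;
  apply: (@wsum_lt i c d j) => // k; rewrite ltW.
Qed.

Lemma wsum_norm i (c : 'I_n -> R) :
  `|\sum_j S i j * c j| <= \sum_j S i j * `|c j|.
Proof.
apply: le_trans (ler_norm_sum _ _ _) _; apply: ler_sum => j _.
by rewrite normrM ger0_norm.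
Qed.

Lemma steadyN p x : steady p x -> steady p (- x).
Proof.
move=> px i; rewrite [(- x) 0 i]mxE mulrN px -mulrN -sumrN; congr (_ * _).
by apply: eq_bigr => j _; rewrite [(- x) 0 j]mxE sigmoidN// mulrN.
Qed.

(** At a coordinate [i] of largest modulus, every |psi_j(x_j)| is strictly below |x_i|, so for
    [p <= 1] the weighted sum cannot reach m_i |x_i|. *)
Lemma steady_small p x : 0 < p <= 1 -> steady p x -> x = 0.
Proof.
move=> /andP[p0 p1] px; apply/rowP => k; rewrite mxE.
pose i := [arg max_(i > k) `|x 0 i|]%O.
have xi j : `|x 0 j| <= `|x 0 i| by rewrite /i; case: arg_maxP => // ? _; exact.
suff xi0 : `|x 0 i| <= 0 by apply/eqP; rewrite -normr_le0 (le_trans (xi k)).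
rewrite leNgt; apply/negP => xi0.
have : `|m 0 i * x 0 i| < m 0 i * `|x 0 i|.
  rewrite px normrM gtr0_norm//.
  apply: le_lt_trans (_ : \sum_j S i j * `|psi j (x 0 j)| < _).
    apply: le_trans (_ : 1 * `|\sum_j S i j * psi j (x 0 j)| <= _).
      by rewrite ler_wpM2r.
    by rewrite mul1r wsum_norm.
  rewrite -sumS; apply: wsum_lt_all => j.
  have [->|xj0] := eqVneq (x 0 j) 0; first by rewrite sigmoid0// normr0.
  by apply: lt_le_trans (xi j); exact: sigmoid_norm_lt.
by rewrite normrM gtr0_norm// ltxx.
Qed.

(** Otherwise an edge joins a zero coordinate [i] to a nonzero [j]: the equation at [i] makes a sum
    of nonnegative terms vanish although its term at [j] is positive. *)
Lemma steady_gt0 p x : 0 < p -> steady p x -> x != 0 -> (forall i, 0 <= x 0 i) ->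
  forall i, 0 < x 0 i.
Proof.
move=> p0 px x0 x_ge0 k; rewrite lt_def x_ge0 andbT; apply/negP => /eqP xk.
have [||i [j [+ + Sij]]] := @S_edge [set i | x 0 i == 0]%SET.
- by apply/set0Pn; exists k; rewrite inE xk.
- apply: contra x0 => /eqP E; apply/eqP/rowP => i; rewrite mxE.
  by have := finset.in_setT i; rewrite -E inE => /eqP.
rewrite !inE => /eqP xi xj; have := px i; rewrite xi mulr0 => /esym/eqP.
rewrite mulf_eq0 gt_eqF//= => /eqP E.
have psi_ge0 l : 0 <= psi l (x 0 l) by rewrite sigmoid_ge0.
have := @wsum_lt i (fun=> 0) (fun j => psi j (x 0 j)) j psi_ge0 Sij.
rewrite /= E sigmoid_gt0// lt_def xj x_ge0 => /(_ isT).
by rewrite big1 ?ltxx// => l _; rewrite mulr0.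
Qed.

(** For [t] the least ratio x_i / y_i, t y <= x with equality at a minimizing [i]; if [t < 1],
    strict subhomogeneity of the sigmoids makes the inequality strict there. *)
Lemma steady_pos_le p x y : 0 < p -> steady p x -> steady p y ->
  (forall i, 0 < x 0 i) -> (forall i, 0 < y 0 i) -> forall i, y 0 i <= x 0 i.
Proof.
move=> p0 px py x0 y0 k; pose i := [arg min_(i < k) (x 0 i / y 0 i)]%O.
have ti j : x 0 i / y 0 i <= x 0 j / y 0 j by rewrite /i; case: arg_minP => // ? _; exact.
set t := x 0 i / y 0 i in ti.
have xt j : t * y 0 j <= x 0 j by rewrite -ler_pdivlMr.
have t0 : 0 < t by rewrite divr_gt0.
suff t1 : 1 <= t.
  by apply: le_trans (xt k); rewrite ler_peMl// ltW.
rewrite leNgt; apply/negP => t1.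
have : t * (m 0 i * y 0 i) < m 0 i * x 0 i.
  rewrite px py mulrCA ltr_pM2l// mulr_sumr.
  apply: (@lt_le_trans _ _ (\sum_j S i j * psi j (t * y 0 j))).
    under eq_bigr do rewrite mulrCA.
    by apply: wsum_lt_all => j; apply: sigmoid_scale => //; rewrite t0.
  by apply: wsum_le => j; rewrite sigmoid_le.
by rewrite mulrCA /t divfK ?gt_eqF// ltxx.
Qed.

Lemma steady_pos_unique p x y : 0 < p -> steady p x -> steady p y ->
  (forall i, 0 < x 0 i) -> (forall i, 0 < y 0 i) -> x = y.
Proof.
move=> p0 px py x0 y0; apply/rowP => i; apply/eqP; rewrite eq_le.
by rewrite !(@steady_pos_le p).
Qed.

Lemma sigmoids_near0 (e : R) : 0 < e -> exists2 d, 0 < d &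
  forall j (z : R), `|z| <= d -> `|psi j z - z| <= e * `|z|.
Proof.
move=> e0.
have dP j : exists d, 0 < d /\ forall z : R, `|z| <= d -> `|psi j z - z| <= e * `|z|.
  by have [d] := sigmoid_near0 (psi_odd j) (psi_monotone j) e0; exists d.
have [d Hd] := choice dP.
have [r r0 rd] := common_radius (fun j => (Hd j).1).
exists r => // j x xr; apply: (Hd j).2; exact: le_trans (rd j).
Qed.

(* Knaster-Tarski in the box [e, p]^n, which the increasing map defining
   equilibria sends to itself. *)
Lemma steady_exists p : 1 < p -> exists2 x, steady p x & forall i, 0 < x 0 i.
Proof.
move=> p1; have p0 : 0 < p by apply: lt_trans p1.
(* With this tolerance psi_j(z) >= z / p for small z > 0, so the constant [e] is a subsolution. *)
have [|d d0 Hd] := @sigmoids_near0 (1 - p^-1); first by rewrite subr_gt0 invf_lt1.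
pose e := Num.min d 1.
have e0 : 0 < e by rewrite lt_min d0 ltr01.
have ep : e <= p by rewrite ge_min (ltW p1) orbT.
have psie j : e <= p * psi j e.
  have := Hd j e; rewrite gtr0_norm// ge_min lexx => /(_ isT)/ler_normlP[+ _].
  rewrite mulrBl mul1r => H; have : p^-1 * e <= psi j e by lra.
  by rewrite ler_pdivrMl.
pose T (x : 'I_n -> R) i := p / m 0 i * \sum_j S i j * psi j (x j).
have T_homo (x y : 'I_n -> R) : (forall i, x i <= y i) -> forall i, T x i <= T y i.
  move=> xy i; rewrite ler_wpM2l ?divr_ge0 ?(ltW p0) ?(ltW (m_gt0 _))//.
  by apply: wsum_le => j; rewrite sigmoid_le.
have Te i : e <= T (fun=> e) i.
  rewrite /T mulrAC ler_pdivlMr// mulrC -sumS mulr_sumr; apply: ler_sum => j _.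
  by rewrite mulrCA ler_wpM2l.
have Tp (x : 'I_n -> R) i : T x i <= p.
  rewrite /T mulrAC ler_pdivrMr// ler_pM2l// -[leRHS]mulr1 -sumS.
  by apply: wsum_le => j; exact: sigmoid_le1.
pose K := [set x : 'I_n -> R | forall i, e <= x i <= p /\ x i <= T x i].
(* The pointwise supremum of the subsolutions satisfies [s <= T s]; then [T s] is a subsolution too,
   whence [T s <= s]. *)
pose s i := sup [set x i | x in K].
have Ke : K (fun=> e) by move=> i; rewrite lexx ep; split.
have Ks i : has_sup [set x i | x in K].
  split; first by exists e, (fun=> e).
  by exists p => _ [x Kx <-]; have [/andP[]] := Kx i.
have le_s (x : 'I_n -> R) i : K x -> x i <= s i.
  by move=> Kx; apply: sup_upper_bound => //; exists x.
have s_le i b : (forall x : 'I_n -> R, K x -> x i <= b) -> s i <= b.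
  by move=> H; apply: ge_sup => [|_ [x Kx <-]]; [exists e, (fun=> e)|exact: H].
have sT i : s i <= T s i.
  apply: s_le => x Kx; apply: le_trans (Kx i).2 _; apply: T_homo => j; exact: le_s.
have KT : K (T s).
  move=> i; split; last by apply: T_homo.
  rewrite Tp andbT; apply: le_trans (Te i) _; apply: T_homo => j; exact: (le_s _ _ Ke).
have Ts i : T s i = s i by apply/eqP; rewrite eq_le sT andbT; exact: le_s.
exists (\row_i s i) => i; rewrite [(\row_(k < n) s k) 0 i]mxE.
  rewrite -Ts /T mulrA [m 0 i * _]mulrC divfK ?gt_eqF//.
  by congr (_ * _); apply: eq_bigr => j _; rewrite mxE.
by apply: lt_le_trans e0 _; exact: (le_s _ _ Ke).
Qed.

(** Discrete maximum principle: being orthogonal to the constants, [e] has a positive maximum and is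
    not constant. An edge leaves the set where the maximum is attained, and the eigenvalue equation
    at its origin gives [l < 1]. *)
Lemma eigenvalue_lt1 (e : 'rV[R]_n) (l : R) : e *m S = l *: (e *m diag_mx m) ->
  e != 0 -> dot e ones = 0 -> l < 1.
Proof.
move=> eS e0 e1.
have sum0 : \sum_i m 0 i * e 0 i = 0.
  by rewrite -[RHS]e1 /dot bform_diag; apply: eq_bigr => i _; rewrite [ones _ _]mxE mulr1.
have eE i : \sum_j S i j * e 0 j = l * (m 0 i * e 0 i).
  have /rowP/(_ i) := eS; rewrite mul_mx_diag [LHS]mxE [in RHS]mxE [X in _ * X]mxE.
  rewrite [e 0 i * _]mulrC => <-; apply: eq_bigr => j _.
  by rewrite mulrC [in LHS]S_sym.
have [k ek] : exists k, 0 < e 0 k.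
  apply: contrapT => /forallNP e_le0; case/negP: e0; apply/eqP/rowP => i.
  rewrite [RHS]mxE; have me0 j : 0 <= - (m 0 j * e 0 j).
    by rewrite oppr_ge0 mulr_ge0_le0 ?(ltW (m_gt0 _))// leNgt; apply/negP.
  have /eqP : \sum_i - (m 0 i * e 0 i) = 0 by rewrite sumrN sum0 oppr0.
  rewrite psumr_eq0// => /allP/(_ i); rewrite mem_index_enum => /(_ isT)/=.
  by rewrite oppr_eq0 mulf_eq0 gt_eqF//= => /eqP.
pose i0 := [arg max_(i > k) e 0 i]%O.
have ei0 j : e 0 j <= e 0 i0 by rewrite /i0; case: arg_maxP => // ? _; exact.
have ei0_gt0 : 0 < e 0 i0 by apply: lt_le_trans (ei0 k).
have [||i [j [+ + Sij]]] := @S_edge [set i | e 0 i == e 0 i0]%SET.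
- by apply/set0Pn; exists i0; rewrite inE.
- apply/negP => /eqP E; suff : 0 < \sum_i m 0 i * e 0 i by rewrite sum0 ltxx.
  rewrite (bigD1 i0)//= ltr_pwDl ?mulr_gt0// sumr_ge0// => i _.
  rewrite mulr_ge0 ?(ltW (m_gt0 _))//; have := finset.in_setT i.
  by rewrite -E inE => /eqP ->; exact: ltW.
rewrite !inE => /eqP ei ej.
have := @wsum_lt i (fun j => e 0 j) (fun=> e 0 i0) j ei0 Sij.
rewrite /= lt_neqAle ej ei0 => /(_ isT).
by rewrite eE sumS ei gtr_pMl// mulr_gt0.
Qed.

(* On the span of the positive and negative parts of [psi x] the form of [S],
   multiplied by [p], exceeds the weighted square norm; the combination
   orthogonal to the constants then tests the second eigenvalue. *)
Lemma steady_sign_change p x i0 j0 : 0 < p -> steady p x ->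
  0 < x 0 i0 -> x 0 j0 < 0 ->
  exists2 w, dot w ones = 0 & dot w w < p * bform S w w.
Proof.
move=> p0 px xi0 xj0.
pose u : 'rV[R]_n := \row_i (if 0 < x 0 i then psi i (x 0 i) else 0).
pose v : 'rV[R]_n := \row_i (if x 0 i < 0 then psi i (x 0 i) else 0).
have uE i : u 0 i = if 0 < x 0 i then psi i (x 0 i) else 0 by rewrite mxE.
have vE i : v 0 i = if x 0 i < 0 then psi i (x 0 i) else 0 by rewrite mxE.
have psi_lt0 i : x 0 i < 0 -> psi i (x 0 i) < 0.
  by move=> xi; rewrite -(sigmoid0 (psi_odd i)) sigmoid_lt.
have uvE i : u 0 i + v 0 i = psi i (x 0 i).
  rewrite uE vE; case: (ltgtP (x 0 i) 0) => [||->]; rewrite ?addr0 ?add0r//.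
  by rewrite sigmoid0.
have u_ge0 i : 0 <= u 0 i.
  by rewrite uE; case: ifP => // xi; rewrite sigmoid_ge0// ltW.
have v_le0 i : v 0 i <= 0.
  by rewrite vE; case: ifP => // xi; rewrite ltW ?psi_lt0.
have uv0 i : u 0 i * v 0 i = 0.
  by rewrite uE vE; case: (ltgtP (x 0 i) 0) => _; rewrite ?mulr0 ?mul0r.
pose f (w : 'rV[R]_n) := \sum_i m 0 i * x 0 i * w 0 i.
have fE w : f w = p * (bform S u w + bform S v w).
  rewrite -bformDl bformE exchange_big/= mulr_sumr; apply: eq_bigr => i _.
  rewrite px -mulrA mulr_suml; congr (_ * _); apply: eq_bigr => j _.
  by rewrite mxE uvE [S j i]S_sym.
have psi_le i : `|psi i (x 0 i)| <= `|x 0 i| by exact: sigmoid_norm_le.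
have fu : dot u u < f u.
  rewrite /dot bform_diag /f; apply: (@sum_lt _ _ _ _ i0) => [i|].
    rewrite -!mulrA ler_wpM2l ?(ltW (m_gt0 _))//.
    have := u_ge0 i; rewrite uE; case: ifP => [xi psi0|_ _]; last by rewrite !mulr0.
    by rewrite ler_wpM2r// ltW// sigmoid_lt_id.
  have ui : u 0 i0 = psi i0 (x 0 i0) by rewrite uE xi0.
  have ui0 : 0 < u 0 i0 by rewrite ui sigmoid_gt0.
  by rewrite ltr_pM2r// ltr_pM2l// ui sigmoid_lt_id.
have fv : dot v v < f v.
  rewrite /dot bform_diag /f; apply: (@sum_lt _ _ _ _ j0) => [i|].
    rewrite -!mulrA ler_wpM2l ?(ltW (m_gt0 _))//.
    have := v_le0 i; rewrite vE; case: ifP => [xi psi0|_ _]; last by rewrite !mulr0.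
    rewrite ler_wnM2r//; have := psi_le i.
    by rewrite !ler0_norm ?lerN2// ltW.
  have vi : v 0 j0 = psi j0 (x 0 j0) by rewrite vE xj0.
  have vi0 : v 0 j0 < 0 by rewrite vi psi_lt0.
  rewrite -!mulrA ltr_pM2l// ltr_nM2r// vi.
  have := @sigmoid_norm_lt _ _ (psi_odd j0) (psi_monotone j0) (psi_sigmoidal j0) (x 0 j0).
  by rewrite lt_eqF// => /(_ isT); rewrite !ltr0_norm ?ltrN2// psi_lt0.
have duv : dot u v = 0.
  by rewrite /dot bform_diag big1// => i _; rewrite -mulrA uv0 mulr0.
have suv : bform S u v <= 0.
  rewrite bformE; apply: sumr_le0 => i _; apply: sumr_le0 => j _.
  by rewrite mulr_ge0_le0// mulr_ge0.
have svu : bform S v u = bform S u v by apply: bformC.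
have dvu : dot v u = 0 by rewrite /dot bformC ?tr_diag_mx.
(* These coefficients make a u + b v orthogonal to the constants; both are positive since u >= 0 >=
   v and neither vanishes. *)
pose a := - dot v ones; pose b := dot u ones.
have dot1 w : dot w ones = \sum_i m 0 i * w 0 i.
  by rewrite /dot bform_diag; apply: eq_bigr => i _; rewrite [ones _ _]mxE mulr1.
have a0 : 0 < a.
  rewrite /a dot1 -sumrN; apply: (@sum_gt0 _ _ _ j0) => [i|].
    by rewrite oppr_ge0 mulr_ge0_le0// ltW.
  by rewrite oppr_gt0 pmulr_rlt0// vE xj0 psi_lt0.
have b0 : 0 < b.
  rewrite /b dot1; apply: (@sum_gt0 _ _ _ i0) => [i|]; first by rewrite mulr_ge0// ltW.
  by rewrite mulr_gt0// uE xi0 sigmoid_gt0.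
exists (a *: u + b *: v).
  by rewrite /dot bformDl !bformZl -!/dot /a /b; ring.
rewrite /dot !(bformDl, bformDr, bformZl, bformZr) -!/dot duv dvu svu.
move: (fE u) (fE v) fu fv; rewrite svu => -> -> fu fv.
have ha : a ^+ 2 * dot u u < a ^+ 2 * (p * (bform S u u + bform S u v)).
  by rewrite ltr_pM2l// exprn_gt0.
have hb : b ^+ 2 * dot v v < b ^+ 2 * (p * (bform S u v + bform S v v)).
  by rewrite ltr_pM2l// exprn_gt0.
(* The sum of [ha] and [hb] weighs S(u, v) by a^2 + b^2 instead of 2 a b; as S(u, v) <= 0, the
   difference has the favorable sign. *)
have hc : p * bform S u v * (a - b) ^+ 2 <= 0.
  by rewrite mulr_le0_ge0 ?sqr_ge0// mulr_ge0_le0// ltW.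
nra.
Qed.

End Network.

(** * An odd descent has no path between opposite points *)

Lemma continuous_row (R : realType) (n k : nat) (f : 'I_n -> 'rV[R]_k -> R) :
  (forall i, continuous (f i)) -> continuous (fun x => \row_i f i x).
Proof.
move=> cf x A /= /nbhs_ballP[e /= e0 eA].
have H : \forall y \near x, forall i, ball (f i x) e (f i y).
  apply: (@filter_forall _ _ _ (nbhs x) (nbhs_filter x)) => i.
  by apply: cf; exact: nbhsx_ballx.
apply: (@filterS _ (nbhs x) _ _ _ _ H) => y fxy; apply: eA; split=> // j i.
by rewrite !mxE; exact: fxy.
Qed.

Section Sinks.
Context {R : realType} {V : normedModType R}.
Variables (G : V -> V) (E : V -> R) (B : set V) (a : V).
Hypotheses (cG : continuous G) (cE : continuous E) (cB : compact B).
Hypotheses (GN : forall x, G (- x) = - G x) (EN : forall x, E (- x) = E x).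
Hypotheses (BN : forall x, B x -> B (- x)) (GB : forall x, B x -> B (G x)).
Hypothesis E_decr : forall x, G x != x -> E (G x) < E x.
Hypothesis fix_lt0 : forall x, G x = x -> E x < 0 -> x = a \/ x = - a.
Hypothesis a_neq0 : a != 0.

Let E_le x : E (G x) <= E x.
Proof. by have [->//|/E_decr/ltW] := eqVneq (G x) x. Qed.

Let iterB k x : B x -> B (iter k G x).
Proof. by move=> Bx; elim: k => //= k; exact: GB. Qed.

Let iterN k x : iter k G (- x) = - iter k G x.
Proof. by elim: k => //= k ->. Qed.

Let iterE k x : E (iter k G x) <= E x.
Proof. by elim: k => //= k; exact: le_trans (E_le _). Qed.

(** While the energy stays at least [e], the iterates remain in a compact set of negative energies
    above [E a], which contains no fixed point. There the energy drop has a positive minimum, so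
    finitely many steps suffice. *)
Lemma iter_below (x : V) (e : R) : B x -> E x < 0 -> E a < e ->
  exists k, E (iter k G x) < e.
Proof.
move=> Bx Ex ae; apply: contrapT => /forallNP ge_e.
have {}ge_e k : e <= E (iter k G x) by rewrite leNgt; apply/negP/ge_e.
pose K := B `&` [set y | e <= E y <= E x].
have cK : compact K.
  apply: compact_closedI => //.
  rewrite (_ : mkset _ = E @^-1` `[e, E x]%classic); last first.
    by apply/seteqP; split=> y /=; rewrite in_itv.
  by apply: closed_comp => [y _|]; [exact: cE|exact: itv_closed].
have K0 : K !=set0 by exists x; split=> //=; rewrite lexx (ge_e 0%N).
have [|z + zmin] := @compact_EVT_min _ _ (fun y => E y - E (G y)) K K0 cK.
  apply: continuous_subspaceT => y; apply: cvgB; first exact: cE.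
  by apply: continuous_comp; [exact: cG|exact: cE].
rewrite inE => -[Bz /andP[ez zx]].
pose d := E z - E (G z).
have d0 : 0 < d.
  rewrite subr_gt0; apply: E_decr; apply/eqP => Gz.
  have [] := fix_lt0 Gz (le_lt_trans zx Ex) => za; move: ez; rewrite za ?EN leNgt ae//.
have Ek k : E (iter k G x) <= E x - k%:R * d.
  elim: k => [|k IH]; first by rewrite mul0r subr0.
  have : d <= E (iter k G x) - E (G (iter k G x)).
    by apply: zmin; rewrite inE; split; [exact: iterB|rewrite /= ge_e iterE].
  rewrite /= -natr1; lra.
have := Ek (Num.bound ((E x - e) / d)); have := ge_e (Num.bound ((E x - e) / d)).
have : (E x - e) / d < (Num.bound ((E x - e) / d))%:R.
  apply: archi_boundP; rewrite divr_ge0 ?subr_ge0 ?(ltW d0)//; exact: (ge_e 0%N).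
rewrite ltr_pdivrMr//; lra.
Qed.

(* Two disjoint open basins, exchanged by x |-> - x, would cover the path. *)
Lemma no_antipodal_path (c : R -> V) : continuous c -> c 1 = - c 0 ->
  ~ (forall t, 0 <= t <= 1 -> B (c t) /\ E (c t) < 0).
Proof.
move=> cc c1 Hc.
have i0 : 0 <= (0 : R) <= 1 by rewrite lexx ler01.
have i1 : 0 <= (1 : R) <= 1 by rewrite lexx ler01.
have B0 : B !=set0 by exists (c 0); have [] := Hc _ i0.
(* A minimizer [b] of [E] on [B] is a fixed point of negative energy, hence [a] or [- a]; this
   yields both [G a = a] and the minimality of [E a]. *)
have [|b Bb bmin] := @compact_EVT_min _ _ E B B0 cB.
  exact: continuous_subspaceT.
have {}bmin x : B x -> E b <= E x by move=> Bx; apply: bmin; rewrite inE.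
have {}Bb : B b by rewrite inE in Bb.
have minP x : B x -> E x <= E b -> x = a \/ x = - a.
  move=> Bx xb; have Ex0 : E x < 0.
    apply: le_lt_trans xb _; apply: le_lt_trans (Hc _ i0).2.
    by apply: bmin; have [] := Hc _ i0.
  apply: fix_lt0 => //; apply/eqP; apply: contrapT => /negP/E_decr Gx.
  have := bmin _ (GB Bx); rewrite leNgt (lt_le_trans Gx)//.
have Ea : E a = E b.
  by have [->|->] := minP _ Bb (lexx _); rewrite ?EN.
have Gb : G b = b.
  apply/eqP; apply: contrapT => /negP/E_decr Gx.
  by have := bmin _ (GB Bb); rewrite leNgt Gx.
have Ga : G a = a.
  have [ba|ba] := minP _ Bb (lexx _); rewrite ba in Gb => //.
  by apply: oppr_inj; rewrite -GN.
have a_gt0 : 0 < `|a| by rewrite normr_gt0.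
(* [G] maps the ball of radius [r] around [a] into the ball of radius |a|, which by [far] does not
   meet its opposite. *)
have [r [r0 Gr]] : exists r : R, 0 < r /\
    forall x, `|a - x| < r -> `|a - x| < `|a| /\ `|a - G x| < `|a|.
  have /cvgrPdist_lt/(_ _ a_gt0)/nbhs_ballP[r /= r0 Hr] := @cG a.
  rewrite Ga in Hr; exists (Num.min r `|a|); split; first by rewrite lt_min r0.
  move=> x; rewrite lt_min => /andP[xr xa]; split=> //; apply: Hr.
  by rewrite -ball_normE.
have far x : `|a - x| < `|a| -> `|a + x| < `|a| -> False.
  move=> h1 h2; have : `|a + a| <= `|a - x| + `|a + x|.
    by apply: le_trans (ler_normD _ _); rewrite addrACA addNr addr0.
  by rewrite -mulr2n normrMn; move: h1 h2; lra.
have cnormB : continuous (fun x : V => `|a - x|).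
  by move=> x; apply: cvg_norm; apply: cvgB; [exact: cvg_cst|exact: cvg_id].
have cnormD : continuous (fun x : V => `|a + x|).
  by move=> x; apply: cvg_norm; apply: cvgD; [exact: cvg_cst|exact: cvg_id].
(* Take for [e] the least energy in [B] at distance at least [r] from both [a] and [- a], or any
   value above [E a] if there is no such point. *)
have [e Eae He] : exists2 e, E a < e &
    forall x, B x -> E x < e -> `|a - x| < r \/ `|a + x| < r.
  pose K := B `&` ([set x | r <= `|a - x|] `&` [set x | r <= `|a + x|]).
  have cK : compact K.
    apply: compact_closedI => //; apply: closedI.
    - apply: (@closed_comp _ _ (fun x => `|a - x|) [set y | r <= y]);
        last exact: closed_ge.
      by move=> x _; exact: cnormB.
    - apply: (@closed_comp _ _ (fun x => `|a + x|) [set y | r <= y]);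
        last exact: closed_ge.
      by move=> x _; exact: cnormD.
  have [[x0 Kx0]|K0] := pselect (K !=set0); last first.
    exists (E a + 1); first by rewrite ltrDl.
    move=> x Bx _; apply: contrapT => /not_orP[/negP + /negP].
    by rewrite -!leNgt => h1 h2; apply: K0; exists x.
  have [||z Kz zmin] := @compact_EVT_min _ _ E K _ cK; first by exists x0.
    exact: continuous_subspaceT.
  move: Kz; rewrite inE => -[Bz [/= z1 z2]].
  exists (E z).
    rewrite ltNge; apply/negP; rewrite Ea => /(minP _ Bz)[] za; move: z1 z2.
      by rewrite za subrr normr0 leNgt r0.
    by rewrite za subrr normr0 => _; rewrite leNgt r0.
  move=> x Bx xz; apply: contrapT => /not_orP[/negP + /negP].
  rewrite -!leNgt => h1 h2; move: xz; rewrite ltNge zmin// inE; split=> //.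
(* [W] is a trap around [a]: the energy stays below [e], so the next iterate is near [a] or [- a],
   and the choice of [r] rules out [- a]. *)
pose W x := `|a - x| < r /\ E x < e.
have WG x : B x -> W x -> W (G x).
  move=> Bx [xr xe]; have Ge : E (G x) < e by apply: le_lt_trans xe.
  split=> //; have [//|h] := He _ (GB Bx) Ge; exfalso.
  apply: (far (G x)); first exact: (Gr _ xr).2.
  by have := h; rewrite -[G x]opprK => /Gr[]; rewrite opprK.
have Viter k l x : B x -> W (iter k G x) -> W (iter (l + k) G x).
  by move=> Bx Vx; elim: l => //= l; apply: WG; exact: iterB.
have Wopen (h : R -> V) : continuous h -> open [set t | W (h t)].
  move=> ch; apply: openI.
  - apply: (@open_comp _ _ (fun t => `|a - h t|) [set y | y < r]); last exact: open_lt.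
    by move=> t _; apply: (continuous_comp (f := h) (g := fun x => `|a - x|));
      [exact: ch|exact: cnormB].
  - apply: (@open_comp _ _ (fun t => E (h t)) [set y | y < e]); last exact: open_lt.
    by move=> t _; apply: (continuous_comp (f := h) (g := E)); [exact: ch|exact: cE].
have citer k : continuous (fun t => iter k G (c t)).
  by elim: k => //= k ck t; apply: continuous_comp; [exact: ck|exact: cG].
pose U := [set t | exists k, W (iter k G (c t))].
pose U' := [set t | exists k, W (- iter k G (c t))].
have Uo : open U.
  rewrite (_ : U = \bigcup_k [set t | W (iter k G (c t))]).
    by apply: bigcup_open => k _; exact: Wopen.
  by apply/seteqP; split=> t [k]; [exists k|move=> _; exists k].
have U'o : open U'.
  rewrite (_ : U' = \bigcup_k [set t | W (- iter k G (c t))]).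
    by apply: bigcup_open => k _; apply: Wopen => t; apply: cvgN; exact: citer.
  by apply/seteqP; split=> t [k]; [exists k|move=> _; exists k].
have UU' t : 0 <= t <= 1 -> U t -> U' t -> False.
  move=> /Hc[Bt _] [k Vk] [l]; rewrite -iterN => Vl.
  have [h1 _] := Viter k l _ Bt Vk; have [+ _] := Viter l k _ (BN Bt) Vl.
  rewrite iterN opprK addnC => h2.
  apply: (far (iter (l + k) G (c t))); first exact: (Gr _ h1).1.
  by have := Gr (- iter (l + k) G (c t)); rewrite opprK => /(_ h2)[].
have cover t : 0 <= t <= 1 -> U t \/ U' t.
  move=> /Hc[Bt Et]; have [k ke] := iter_below Bt Et Eae.
  have [h|h] := He _ (iterB k Bt) ke; [left|right]; exists k; split=> //.
    by rewrite opprK.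
  by rewrite EN.
have UN : (U 0 -> U' 1) /\ (U' 0 -> U 1).
  by split=> -[k]; rewrite ?c1 => Vk; exists k; rewrite c1 iterN ?opprK.
have itv01 t : `[0, 1]%classic t = (0 <= t <= 1) :> Prop by rewrite /= in_itv.
(* The basin containing 0 is relatively open and closed in [0, 1], hence contains 1; by oddness 1
   also lies in the other basin. *)
have [U0|U0] := cover _ i0.
  have /seteqP[_ /(_ 1)] : `[0, 1]%classic `&` U = `[0, 1]%classic.
    apply: (@segment_connected R 0 1); first by exists 0; split=> //; rewrite itv01.
    - by exists U.
    - exists (~` U'); first exact: open_closedC.
      apply/seteqP; split=> t [t01]; rewrite itv01 in t01 => Ut; split; rewrite ?itv01//.
        by move=> U't; exact: (UU' t).
      by have [|/Ut] := cover t t01.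
  by rewrite itv01 => /(_ i1)[_ U1]; exact: (UU' 1 i1 U1 (UN.1 U0)).
have /seteqP[_ /(_ 1)] : `[0, 1]%classic `&` U' = `[0, 1]%classic.
  apply: (@segment_connected R 0 1); first by exists 0; split=> //; rewrite itv01.
  - by exists U'.
  - exists (~` U); first exact: open_closedC.
    apply/seteqP; split=> t [t01]; rewrite itv01 in t01 => Ut; split; rewrite ?itv01//.
      by move=> U't; exact: (UU' t).
    by have [/Ut|] := cover t t01.
by rewrite itv01 => /(_ i1)[_ U1]; exact: (UU' 1 i1 (UN.2 U0) U1).
Qed.

End Sinks.

(** * The third equilibrium *)

Lemma lipschitz1_continuous (R : realType) (h : R -> R) :
  (forall x y, `|h x - h y| <= `|x - y|) -> continuous h.
Proof.
move=> hL x; apply/cvgrPdist_lt => e e0; exists e => //= y xy.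
exact: le_lt_trans (hL x y) xy.
Qed.

Lemma continuous_coord (R : realType) (n : nat) (h : R -> R) (i : 'I_n) :
  continuous h -> continuous (fun x : 'rV[R]_n => h (x 0 i)).
Proof.
move=> ch x.
by apply: (continuous_comp (f := fun x : 'rV[R]_n => x 0 i));
  [exact: coord_continuous|exact: ch].
Qed.

Lemma continuous_wsum (R : realType) (n k : nat) (c : 'I_n -> R)
    (h : 'I_n -> 'rV[R]_k -> R) :
  (forall j, continuous (h j)) -> continuous (fun x => \sum_j c j * h j x).
Proof.
move=> ch; apply: continuous_big => [|j _]; first exact: add_continuous.
by move=> x; exact: (continuousM (@cst_continuous _ _ (c j) x) (ch j x)).
Qed.

(** The map x + p f(x) expands distances, so its inverse is 1-Lipschitz; since |f| <= 1, the
    intermediate value theorem on [-(|y| + p), |y| + p] gives surjectivity. *)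
Lemma damped_sigmoid_inverse (R : realType) (f : R -> R) (p : R) : 0 < p ->
  odd_fun f -> monotone_fun f -> saturated f -> exists g : R -> R,
  [/\ forall y, g y + p * f (g y) = y, forall x y, x + p * f x = y -> x = g y &
      forall x y, `|g x - g y| <= `|x - y|].
Proof.
move=> p0 fo fm fs; pose h x := x + p * f x.
have hlip x y : x <= y -> y - x <= h y - h x.
  move=> xy; rewrite /h; have : p * f x <= p * f y by rewrite ler_pM2l// sigmoid_le.
  lra.
have hdist x y : `|x - y| <= `|h x - h y|.
  wlog xy : x y / y <= x => [H|].
    by have [/H//|/ltW/H] := leP y x; rewrite distrC [X in _ <= X -> _]distrC.
  by rewrite [leLHS]ger0_norm ?subr_ge0//; apply: le_trans (hlip _ _ xy) (ler_norm _).
have ch : continuous h.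
  move=> x; apply: cvgD; first exact: cvg_id.
  by apply: cvgM; [exact: cvg_cst|exact: sigmoid_continuous].
have surj y : exists x, h x = y.
  have f1 x : `|f x| <= 1 by exact: sigmoid_norm_le1.
  have [|||c _ hc] := @IVT R h (- (`|y| + p)) (`|y| + p) y.
  - by have := normr_ge0 y; lra.
  - exact: continuous_subspaceT.
  - have /ler_normlP[h1 h2] : `|y| <= `|y| by [].
    have /ler_normlP[k1 k2] := f1 (`|y| + p).
    have /ler_normlP[k3 k4] := f1 (- (`|y| + p)).
    rewrite /h ge_min le_max; apply/andP; split; apply/orP; [left|right]; nra.
  by exists c.
have [g gP] := choice surj.
exists g; split => [y|x y hx|x y]; first exact: gP.
  have := hdist x (g y); rewrite gP [h x]hx subrr normr0 normr_le0 subr_eq0.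
  by move/eqP.
by apply: le_trans (hdist _ _) _; rewrite !gP.
Qed.

(** * The descent map, its energy and the extra equilibrium *)

Section Dynamics.
Context {R : realType} {n : nat}.
Variables (S : 'M[R]_n) (psi : 'I_n -> R -> R).
Let m : 'rV[R]_n := \row_i \sum_j S i j.
Hypotheses (ST : S^T = S) (S_ge0 : forall i j, 0 <= S i j).
Hypothesis m_gt0 : forall i, 0 < m 0 i.
Hypotheses (psi_odd : forall i, odd_fun (psi i))
  (psi_monotone : forall i, monotone_fun (psi i))
  (psi_saturated : forall i, saturated (psi i))
  (psi_sigmoidal : forall i, sigmoidal (psi i)).
Let dot := bform (diag_mx m).
Let ones : 'rV[R]_n := const_mx 1.
Let Psi (x : 'rV[R]_n) : 'rV[R]_n := \row_i psi i (x 0 i).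

Lemma wsum_row (h : 'I_n -> R) : \sum_i \sum_j S i j * h i = \sum_i m 0 i * h i.
Proof. by apply: eq_bigr => i _; rewrite [m 0 i]mxE mulr_suml. Qed.

Lemma wsum_col (h : 'I_n -> R) : \sum_i \sum_j S i j * h j = \sum_i m 0 i * h i.
Proof.
rewrite exchange_big/= -wsum_row; apply: eq_bigr => i _; apply: eq_bigr => j _.
by rewrite -[in RHS]ST mxE.
Qed.

(** The signless Laplacian is nonnegative: the sum of the S_ij (d_i + d_j)^2 is twice
    [dot d d + bform S d d]. *)
Lemma bform_ge_dot (d : 'rV[R]_n) : - dot d d <= bform S d d.
Proof.
have dE : dot d d = \sum_i m 0 i * d 0 i ^+ 2.
  by rewrite /dot bform_diag; apply: eq_bigr => i _; rewrite expr2 mulrA.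
have : 0 <= \sum_i \sum_j S i j * (d 0 i + d 0 j) ^+ 2.
  by apply: sumr_ge0 => i _; apply: sumr_ge0 => j _; rewrite mulr_ge0 ?sqr_ge0.
have -> : \sum_i \sum_j S i j * (d 0 i + d 0 j) ^+ 2 =
    (dot d d + dot d d) + 2 * bform S d d.
  rewrite {1}dE -wsum_row dE -wsum_col bformE mulr_sumr -!big_split/=.
  apply: eq_bigr => i _; rewrite mulr_sumr -!big_split/=.
  by apply: eq_bigr => j _; ring.
lra.
Qed.

Lemma PsiN (x : 'rV[R]_n) : Psi (- x) = - Psi x.
Proof. by apply/rowP => i; rewrite !mxE sigmoidN. Qed.

Variable p : R.
Hypothesis p_gt0 : 0 < p.

Section Descent.
Variables (g F : 'I_n -> R -> R).
Hypotheses (gK : forall i y, g i y + p * psi i (g i y) = y)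
  (g_unique : forall i x y, x + p * psi i x = y -> x = g i y)
  (g_lip : forall i x y, `|g i x - g i y| <= `|x - y|).
Hypotheses (FN : forall i x, F i (- x) = F i x) (F0 : forall i, F i 0 = 0)
  (F_sub : forall i x y, psi i x * (y - x) <= F i y - F i x)
  (F_ge : forall i c d, (forall x, 0 <= x <= d -> c * x <= psi i x) ->
     forall x, `|x| <= d -> c * x ^+ 2 / 2 <= F i x).

Let target (x : 'rV[R]_n) i :=
  p / m 0 i * (\sum_j S i j * psi j (x 0 j)) + p * psi i (x 0 i).
Let G (x : 'rV[R]_n) : 'rV[R]_n := \row_i g i (target x i).
(** By [F_sub], x psi(x) - F(x) is the Legendre transform of F at y = psi(x), so the first sum is
    convex as a function of y. *)
Let E (x : 'rV[R]_n) : R := \sum_i m 0 i * (x 0 i * psi i (x 0 i) - F i (x 0 i)) -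
  p / 2 * bform S (Psi x) (Psi x).

Let psi_cont i : continuous (psi i) := sigmoid_continuous (psi_monotone i).

Lemma descent_continuous : continuous G.
Proof.
apply: continuous_row => i.
have ct : continuous (fun x => target x i).
    have c1 : continuous (fun x : 'rV[R]_n => \sum_j S i j * psi j (x 0 j)).
      by apply: continuous_wsum => j; exact: continuous_coord.
    have c2 : continuous (fun x : 'rV[R]_n => psi i (x 0 i)) by exact: continuous_coord.
    move=> x; exact: (continuousD (continuousM (@cst_continuous _ _ (p / m 0 i) x) (c1 x))
      (continuousM (@cst_continuous _ _ p x) (c2 x))).
move=> x; apply: (continuous_comp (f := fun x => target x i)); first exact: ct.
by apply: lipschitz1_continuous.
Qed.

Lemma F_continuous i : continuous (F i).
Proof.
apply: lipschitz1_continuous.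
have H x y : F i x - F i y <= `|x - y|.
  have := F_sub i x y.
  have f1 :=
    sigmoid_norm_le1 (psi_odd i) (psi_monotone i) (psi_saturated i) x.
  have : psi i x * (x - y) <= `|x - y|.
    apply: le_trans (ler_norm _) _; rewrite normrM ler_piMl//.
  lra.
by move=> x y; rewrite ler_norml H andbT lerNl opprB distrC.
Qed.

Lemma energy_continuous : continuous E.
Proof.
have c1 : continuous (fun x : 'rV[R]_n =>
    \sum_i m 0 i * (x 0 i * psi i (x 0 i) - F i (x 0 i))).
  apply: continuous_wsum => j.
  apply: (@continuous_coord _ _ (fun z => z * psi j z - F j z)).
  move=> z; apply: cvgB; last exact: F_continuous.
  by apply: cvgM; [exact: cvg_id|exact: psi_cont].
have cPsi : continuous Psi by apply: continuous_row => j; exact: continuous_coord.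
have c2 : continuous (fun x => bform S (Psi x) (Psi x)) by exact: continuous_bform.
move=> x.
exact: (continuousB (c1 x) (continuousM (@cst_continuous _ _ (p / 2) x) (c2 x))).
Qed.

Lemma descentN (x : 'rV[R]_n) : G (- x) = - G x.
Proof.
apply/rowP => i; rewrite !mxE; apply/esym/g_unique.
rewrite (sigmoidN (psi_odd i)) mulrN -opprD gK /target [(- x) 0 i]mxE.
rewrite (sigmoidN (psi_odd i)) mulrN opprD; congr (_ + _).
rewrite -mulrN -sumrN; congr (_ * _); apply: eq_bigr => j _.
by rewrite [(- x) 0 j]mxE (sigmoidN (psi_odd j)) mulrN.
Qed.

Lemma energyN (x : 'rV[R]_n) : E (- x) = E x.
Proof.
rewrite /E PsiN -[- Psi x]scaleN1r bformZl bformZr !mulN1r opprK.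
congr (_ - _); apply: eq_bigr => i _.
by rewrite [(- x) 0 i]mxE (sigmoidN (psi_odd i)) FN mulrNN.
Qed.

Lemma energy0 : E 0 = 0.
Proof.
have Psi0 : Psi 0 = 0 by apply/rowP => i; rewrite !mxE sigmoid0.
rewrite /E Psi0 /bform !mul0mx mxE mulr0 subr0 big1// => i _.
by rewrite [(0 : 'rV[R]_n) 0 i]mxE F0 mul0r subr0 mulr0.
Qed.

(** The weights S_ij / m_i sum to 1 and |psi| <= 1, so [target] is bounded by 2 p; each [g i] is
    1-Lipschitz and fixes 0. *)
Lemma descent_box (x : 'rV[R]_n) i : `|G x 0 i| <= 2 * p.
Proof.
have g0 : g i 0 = 0 by apply/esym/g_unique; rewrite sigmoid0// mulr0 addr0.
rewrite [G x 0 i]mxE -[g i _]subr0 -g0; apply: le_trans (g_lip _ _ _) _.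
have p1 j : `|psi j (x 0 j)| <= 1 by exact: sigmoid_norm_le1.
rewrite subr0; apply: le_trans (ler_normD _ _) _.
rewrite (_ : 2 * p = p + p); last by ring.
apply: lerD; last by rewrite normrM gtr0_norm// ler_piMr// ltW.
rewrite normrM gtr0_norm ?divr_gt0// mulrAC ler_pdivrMr// ler_pM2l//.
apply: le_trans (ler_norm_sum _ _ _) _; rewrite [leRHS]mxE; apply: ler_sum => j _.
by rewrite normrM ger0_norm// ler_piMr.
Qed.

Lemma descent_fixed (x : 'rV[R]_n) : G x = x <-> steady S psi p x.
Proof.
split=> [Gx i|px].
  have := gK i (target x i); have /rowP/(_ i) := Gx; rewrite [G x 0 i]mxE => -> /addIr.
  by move=> {1}->; rewrite mulrA [_ * (p / _)]mulrC divfK ?gt_eqF.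
apply/rowP => i; rewrite [G x 0 i]mxE; apply/esym/g_unique; congr (_ + _).
by rewrite mulrAC -px -/m mulrC mulKf ?gt_eqF.
Qed.

(* Since S + M >= 0, E is a difference of convex functions; G linearizes the
   subtracted one and minimizes. *)
Lemma energy_descent (x : 'rV[R]_n) :
  E (G x) - E x <= - (p / 2) * dot (Psi (G x) - Psi x) (Psi (G x) - Psi x).
Proof.
set d := Psi (G x) - Psi x.
have PsiG : Psi (G x) = Psi x + d by rewrite addrC subrK.
have dE i : d 0 i = psi i (G x 0 i) - psi i (x 0 i) by rewrite !mxE.
clearbody d.
have sumE : \sum_i m 0 i * G x 0 i * d 0 i = p * bform S (Psi x) d - p * dot d d.
  rewrite /dot bform_diag bformE exchange_big/= !mulr_sumr -sumrB; apply: eq_bigr => i _.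
  have GE : G x 0 i = g i (target x i) by rewrite mxE.
  have := gK i (target x i); rewrite -GE => H.
  have mG : m 0 i * G x 0 i = p * (\sum_j S i j * psi j (x 0 j)) - p * (m 0 i * d 0 i).
    have -> : m 0 i * G x 0 i = m 0 i * target x i - m 0 i * (p * psi i (G x 0 i)).
      by rewrite -H; ring.
    rewrite dE /target; field; by rewrite gt_eqF.
  rewrite mG mulrBl -mulrA; congr (_ - _); last by ring.
  rewrite -mulrA mulr_suml; congr (_ * _); apply: eq_bigr => j _.
  by rewrite [Psi x 0 j]mxE -[in LHS]ST mxE.
(* Convexity of the Legendre transform, whose gradient is taken at the new point. *)
have W_le : \sum_i m 0 i * (G x 0 i * psi i (G x 0 i) - F i (G x 0 i)) -
    \sum_i m 0 i * (x 0 i * psi i (x 0 i) - F i (x 0 i)) <=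
    \sum_i m 0 i * G x 0 i * d 0 i.
  rewrite -sumrB; apply: ler_sum => i _; rewrite -mulrBr -mulrA ler_pM2l// dE.
  by have := F_sub i (x 0 i) (G x 0 i); lra.
rewrite {1}/E {1}/E PsiG !(bformDl, bformDr) [bform S d (Psi x)]bformC//.
(* The terms p S(psi(x), d) cancel; nonnegativity of S + M absorbs S(d, d) and half of p
   [dot d d]. *)
have : 0 <= p * (bform S d d + dot d d).
  by rewrite mulr_ge0 ?(ltW p_gt0)//; have := bform_ge_dot d; lra.
by move: W_le; rewrite sumE; lra.
Qed.

Lemma energy_decr (x : 'rV[R]_n) : G x != x -> E (G x) < E x.
Proof.
move=> Gx; have := energy_descent x; rewrite -subr_lt0 => H.
apply: le_lt_trans H _; rewrite mulNr oppr_lt0 mulr_gt0 ?divr_gt0//.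
rewrite dot_gt0//; apply: contra Gx; rewrite subr_eq0 => /eqP/rowP PG.
apply/eqP/rowP => i; have := PG i; rewrite [LHS]mxE [RHS]mxE => /eqP.
by rewrite (inj_eq (inc_inj (sigmoid_le (psi_monotone i)))) => /eqP.
Qed.

(** Near 0 the energy is at most ([dot x x] - p S(x, x)) / 2 plus a small multiple of [dot x x]; the
    main part is at most (1 - k) / 2 times [dot x x]. *)
Lemma energy_lt0 (k : R) : 1 < k -> exists2 d, 0 < d &
  forall x : 'rV[R]_n, (forall i, `|x 0 i| <= d) -> x != 0 ->
    k * dot x x <= p * bform S x x -> E x < 0.
Proof.
(* The errors add up to e (1 + 2 p) / 2 times [dot x x]; this [e] makes them half of the gap (k - 1)
   / 2. *)
move=> k1; pose e := (k - 1) / (2 * (1 + 2 * p)).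
have p2 : 0 < 1 + 2 * p by rewrite addr_gt0// mulr_gt0.
have e0 : 0 < e by rewrite divr_gt0 ?subr_gt0 ?mulr_gt0.
have eE : e * (1 + 2 * p) = (k - 1) / 2.
  by rewrite /e; field; rewrite gt_eqF.
clearbody e.
have [d d0 Hd] := sigmoids_near0 psi_odd psi_monotone e0.
exists d => // x xd x0 kx.
have psi_id i : `|psi i (x 0 i)| <= `|x 0 i| by exact: sigmoid_norm_le.
have dx : 0 < dot x x by rewrite dot_gt0.
have dE : dot x x = \sum_i m 0 i * x 0 i ^+ 2.
  by rewrite /dot bform_diag; apply: eq_bigr => i _; rewrite expr2 mulrA.
have quad : bform S x x - e * (dot x x + dot x x) <= bform S (Psi x) (Psi x).
  rewrite {1}dE -wsum_row dE -wsum_col !bformE -big_split mulr_sumr -sumrB/=.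
  apply: ler_sum => i _; rewrite -big_split mulr_sumr -sumrB/=; apply: ler_sum => j _.
  rewrite ![Psi x _ _]mxE -mulrDr mulrCA -!mulrA -mulrBr ler_wpM2l//.
  have : `|psi i (x 0 i) * psi j (x 0 j) - x 0 i * x 0 j| <=
      e * (x 0 i ^+ 2 + x 0 j ^+ 2).
    have -> : psi i (x 0 i) * psi j (x 0 j) - x 0 i * x 0 j =
      psi i (x 0 i) * (psi j (x 0 j) - x 0 j) + (psi i (x 0 i) - x 0 i) * x 0 j by ring.
    apply: le_trans (ler_normD _ _) _; rewrite !normrM.
    have h1 : `|psi i (x 0 i)| * `|psi j (x 0 j) - x 0 j| <= `|x 0 i| * (e * `|x 0 j|).
      by rewrite ler_pM// Hd.
    have h2 : `|psi i (x 0 i) - x 0 i| * `|x 0 j| <= e * `|x 0 i| * `|x 0 j|.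
      by rewrite ler_wpM2r// Hd.
    have h3 : 0 <= e * (`|x 0 i| - `|x 0 j|) ^+ 2 by rewrite mulr_ge0 ?sqr_ge0 ?ltW.
    rewrite -[x 0 i ^+ 2]real_normK ?num_real// -[x 0 j ^+ 2]real_normK ?num_real//.
    nra.
  by move=> /ler_normlP[+ _]; lra.
have pot : \sum_i m 0 i * (x 0 i * psi i (x 0 i) - F i (x 0 i)) <=
    (1 + e) / 2 * dot x x.
  rewrite dE mulr_sumr; apply: ler_sum => i _; rewrite mulrCA ler_pM2l//.
  have Fi : (1 - e) * x 0 i ^+ 2 / 2 <= F i (x 0 i).
    apply: (F_ge (d := d)) => // z /andP[z0 zd].
    by have := Hd i z; rewrite ger0_norm// => /(_ zd)/ler_normlP[+ _]; lra.
  have : x 0 i * psi i (x 0 i) <= x 0 i ^+ 2.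
    apply: le_trans (ler_norm _) _; rewrite normrM -[leRHS]real_normK ?num_real// expr2.
    by rewrite ler_wpM2l.
  lra.
rewrite /E.
have : p * (bform S x x - e * (dot x x + dot x x)) <= p * bform S (Psi x) (Psi x).
  by rewrite ler_pM2l.
have : (e * (1 + 2 * p) - (k - 1) / 2) * dot x x = 0 by rewrite eE subrr mul0r.
have : 0 < (k - 1) * dot x x by rewrite mulr_gt0 ?subr_gt0.
nra.
Qed.

End Descent.

Lemma extra_equilibrium (v a : 'rV[R]_n) (l : R) :
  v *m S = l *: (v *m diag_mx m) -> v != 0 -> dot v ones = 0 -> l <= 1 -> 1 < p * l ->
  a != 0 -> ~ (forall x : 'rV[R]_n, steady S psi p x -> [\/ x = 0, x = a | x = - a]).
Proof.
move=> vS v0 v1 l1 pl a0 only.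
have [g gP] := choice (fun i => damped_sigmoid_inverse p_gt0
  (psi_odd i) (psi_monotone i) (psi_saturated i)).
have [F FP] := choice (fun i => sigmoid_primitive
  (psi_odd i) (psi_monotone i)).
have gK i y : g i y + p * psi i (g i y) = y by have [] := gP i.
have gU i x y : x + p * psi i x = y -> x = g i y by have [_ + _] := gP i; exact.
have gL i x y : `|g i x - g i y| <= `|x - y| by have [_ _] := gP i; exact.
have FN i x : F i (- x) = F i x by have [] := FP i.
have F0 i : F i 0 = 0 by have [] := FP i.
have FS i x y : psi i x * (y - x) <= F i y - F i x by have [_ _ + _] := FP i; exact.
have FG i c d : (forall x, 0 <= x <= d -> c * x <= psi i x) ->
    forall x, `|x| <= d -> c * x ^+ 2 / 2 <= F i x.
  by have [_ _ _] := FP i; exact.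
have S1 : ones *m S = ones *m diag_mx m.
  apply/rowP => i; rewrite mul_mx_diag !mxE mul1r; apply: eq_bigr => j _.
  by rewrite mxE mul1r -[in LHS]ST mxE.
have Bo y : bform S ones y = dot ones y by rewrite /bform S1.
have Bv y : bform S v y = l * dot v y.
  by rewrite /bform vS -scalemxAl mxE.
have vo1 : dot ones v = 0 by rewrite -v1; apply: bformC; rewrite tr_diag_mx.
have [d d0 Hd] := energy_lt0 FG pl.
(* The denominator bounds 1 + |v_i|, which keeps the path in the box and in the range of
   [energy_lt0]. *)
pose s := Num.min d (2 * p) / (1 + \sum_i `|v 0 i|).
have sv0 : 0 < 1 + \sum_i `|v 0 i| by rewrite ltr_pwDl ?sumr_ge0.
have s0 : 0 < s by rewrite divr_gt0// lt_min d0 mulr_gt0.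
(* The path leads from [s *: ones] to its opposite; 1 - 2 t and t (1 - t) never vanish together, so
   it avoids 0. *)
pose c t := s *: ((1 - 2 * t) *: ones + (t * (1 - t)) *: v).
have c_le t i : 0 <= t <= 1 -> `|c t 0 i| <= Num.min d (2 * p).
  move=> /andP[t0 t1].
  have -> : c t 0 i = s * ((1 - 2 * t) + t * (1 - t) * v 0 i) by rewrite !mxE mulr1.
  rewrite normrM gtr0_norm// /s mulrAC ler_pdivrMr// ler_pM2l ?lt_min ?d0 ?mulr_gt0//.
  apply: le_trans (ler_normD _ _) _; apply: lerD; first by rewrite ler_norml; lra.
  rewrite normrM; apply: (@le_trans _ _ `|v 0 i|).
    by rewrite ler_piMl// ger0_norm ?mulr_ge0 ?subr_ge0//; nra.
  by rewrite (bigD1 i)//= lerDl sumr_ge0.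
clearbody s.
apply: (@no_antipodal_path _ _ _ _
  [set x : 'rV[R]_n | forall i, `[- (2 * p), 2 * p]%classic (x ord0 i)] a
  (descent_continuous gL) (energy_continuous FS) _ _ _ _ _ _ _ _ c).
- exact: (@rV_compact _ _ (fun=> `[- (2 * p), 2 * p]%classic)
    (fun=> @segment_compact _ _ _)).
- exact: descentN.
- exact: energyN.
- move=> x Bx i; have := Bx i; rewrite /= !in_itv/= mxE => /andP[h1 h2].
  by apply/andP; split; lra.
- by move=> x _ i; rewrite /= in_itv/= -ler_norml; exact: descent_box.
- by move=> x; exact: energy_decr.
- move=> x /(descent_fixed gK gU)/only [->|->|->]; [|by left|by right].
  by rewrite (energy0 F0) ltxx.
- done.
- move=> t; apply: cvgZl_tmp; apply: cvgD; apply: cvgZr_tmp.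
    by apply: cvgB; [exact: cvg_cst|apply: cvgM; [exact: cvg_cst|exact: cvg_id]].
  apply: cvgM; first exact: cvg_id.
  by apply: cvgB; [exact: cvg_cst|exact: cvg_id].
- by apply/rowP => i; rewrite !mxE; ring.
- move=> t t01; split.
    move=> i; rewrite /= in_itv/= -ler_norml; apply: le_trans (c_le t i t01) _.
    by rewrite ge_min lexx orbT.
  apply: Hd.
  + by move=> i; apply: le_trans (c_le t i t01) _; rewrite ge_min lexx.
  + have o0 : 0 < dot ones ones.
      rewrite dot_gt0//; apply/eqP => /rowP o0; case/negP: v0; apply/eqP/rowP => i.
      by have := o0 i; rewrite !mxE => /eqP; rewrite oner_eq0.
    have dv : 0 < dot v v by rewrite dot_gt0.
    apply/eqP => ct0.
    have : dot (c t) ones = 0 by rewrite ct0 /dot /bform !mul0mx mxE.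
    have : dot (c t) v = 0 by rewrite ct0 /dot /bform !mul0mx mxE.
    rewrite /c /dot !bformZl !bformDl !bformZl -/dot v1 vo1 !mulr0 addr0 add0r => /eqP.
    rewrite !mulf_eq0 (gt_eqF s0) (gt_eqF dv) orbF/= => h /eqP.
    rewrite !mulf_eq0 (gt_eqF s0) (gt_eqF o0) orbF/= => /eqP h'.
    by case/orP: h => /eqP; lra.
  + rewrite /c /dot !(bformZl, bformZr, bformDl, bformDr) -!/dot.
    rewrite !Bo !Bv v1 vo1 !mulr0 !addr0 !add0r.
    (* On the constants S agrees with M, so there p S exceeds the required p l M by this amount. *)
    have : 0 <= p * (1 - l) * (s * (1 - 2 * t)) ^+ 2 * dot ones ones.
      apply: mulr_ge0; last exact: dot_ge0.
      by apply: mulr_ge0; [rewrite mulr_ge0 ?subr_ge0 ?(ltW p_gt0)|exact: sqr_ge0].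
    lra.
Qed.

End Dynamics.

(** * The network equations *)

(** As [l 0] is largest, sorting yields the sorted tail followed by [l 0]; the entry at [n.-2] is
    therefore the maximum of the tail. *)
Lemma sort_second_largest (R : realType) (n : nat) (l : nat -> R) :
  (1 < n)%N -> (forall i, (0 < i < n)%N -> l i <= l 0%N) ->
  exists k, [/\ (0 < k < n)%N,
    (sort <=%R [seq l i | i <- iota 0 n])`_n.-2 = l k &
    forall i, (0 < i < n)%N -> l i <= l k].
Proof.
case: n => [|[|n]]// _ l_le; pose ls := [seq l i | i <- iota 1 n.+1].
have lsP x : reflect (exists2 i, (0 < i < n.+2)%N & x = l i) (x \in sort <=%R ls).
  rewrite mem_sort; apply: (iffP mapP) => -[i ilt ->]; exists i => //.
    by move: ilt; rewrite mem_iota add1n.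
  by rewrite mem_iota add1n.
have sizeE : size (sort <=%R ls) = n.+1 by rewrite size_sort size_map size_iota.
have ss : sorted <=%R (sort <=%R ls) by exact: sort_le_sorted.
have -> : sort <=%R [seq l i | i <- iota 0 n.+2] = rcons (sort <=%R ls) (l 0%N).
  apply: (@le_sorted_eq _ R); first exact: sort_le_sorted.
  - case E : (sort <=%R ls) => [|y s']; first by move: sizeE; rewrite E.
    rewrite /= rcons_path -[path _ _ _]/(sorted <=%R (y :: s')) -E ss/=.
    have /lsP[i ilt ->] : last y s' \in sort <=%R ls by rewrite E mem_last.
    exact: l_le.
  - by rewrite perm_sort perm_sym perm_rcons perm_cons perm_sort.
rewrite nth_rcons sizeE ltnSn.
have /lsP[k klt kE] : (sort <=%R ls)`_n \in sort <=%R ls by rewrite mem_nth ?sizeE.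
exists k; split=> // i ilt; rewrite -kE.
have /(nthP 0)[j jlt <-] : l i \in sort <=%R ls by apply/lsP; exists i.
rewrite sizeE ltnS in jlt.
by apply: (le_sorted_leq_nth 0 ss); rewrite ?inE ?sizeE ?ltnS.
Qed.

(** For [l <= 0] both sides hold: the threshold is infinite and [p * l <= 0]. *)
Lemma lt_threshold (R : realType) (p l : R) :
  0 < p -> (p%:E < threshold l)%E = (p * l < 1).
Proof.
move=> p0; rewrite /threshold; case: ifPn => [l0|].
  by rewrite lte_fin ltr_pdivlMr.
rewrite -leNgt => l0; rewrite ltry; apply/esym.
by apply: le_lt_trans ltr01; rewrite mulr_ge0_le0// ltW.
Qed.

Lemma neq_threshold (R : realType) (p l : R) :
  0 < p -> p%:E != threshold l -> p * l != 1.
Proof.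
move=> p0; apply: contra => /eqP pl.
have l0 : 0 < l by rewrite -(pmulr_rgt0 _ p0) pl.
by rewrite /threshold l0; apply/eqP; congr EFin; rewrite -pl mulfK// gt_eqF.
Qed.

Section Balance.
Context {R : realType} {n : nat}.
Variables (A : 'M[R]_n) (psi : 'I_n -> R -> R) (d : 'rV[R]_n).
Hypotheses (n_gt1 : (1 < n)%N) (A_ge0 : forall i j, 0 <= A i j).
Hypotheses (A_irr : irreducible_mx A) (d_gt0 : forall i, 0 < d 0 i).

(** Irreducibility applied to {i}, a proper subset because [n > 1], gives a nonzero entry in row
    [i]. This makes [Delta A] invertible. *)
Lemma row_sum_gt0 i : 0 < \sum_j A i j.
Proof.
have [||i' [j [+ _ Aij]]] := @irreducible_edge _ _ _ [set i]%SET A_irr.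
- by apply/set0Pn; exists i; rewrite inE.
- apply/eqP => E; have := cardsT 'I_n; rewrite -E cards1 card_ord => n1.
  by move: n_gt1; rewrite -n1.
rewrite inE => /eqP ii; subst i'.
by apply: (@sum_gt0 _ _ _ j) => //; rewrite lt_def Aij A_ge0.
Qed.

Lemma Delta_H1 : Delta A *m H1 A = A.
Proof.
rewrite /H1 mulmxA mulmxV ?mul1mx// unitmxE unitfE det_diag.
by apply/prodf_neq0 => i _; rewrite mxE gt_eqF// row_sum_gt0.
Qed.

Lemma weighted_H1 : diag_mx (\row_i \sum_j (diag_mx d *m A) i j) *m H1 A = diag_mx d *m A.
Proof.
rewrite -[in RHS]Delta_H1 mulmxA /Delta mulmx_diag; congr (diag_mx _ *m _).
apply/rowP => i; rewrite !mxE mulr_sumr; apply: eq_bigr => j _.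
by rewrite mul_diag_mx mxE.
Qed.

(** Since Delta H_1 = A, the vector field is p A psi(x) - Delta x; its coordinates are multiplied by
    the [d 0 i > 0]. *)
Lemma equilibriumE p (x : 'cV[R]_n) :
  equilibrium A psi p x <-> steady (diag_mx d *m A) psi p x^T.
Proof.
have vE i : vector_field A psi p x i 0 =
    p * (\sum_j A i j * psi j (x j 0)) - (\sum_j A i j) * x i 0.
  rewrite /vector_field mulmxDr mulmxN -scalemxAr mulmxA Delta_H1 addrC.
  rewrite mxE [X in X + _]mxE [X in _ + X]mxE.
  congr (_ * _ - _); first by rewrite mxE; apply: eq_bigr => j _; rewrite mxE.
  by rewrite /Delta mul_diag_mx !mxE.
have sE i : (\row_i \sum_j (diag_mx d *m A) i j) 0 i * x^T 0 i =
    d 0 i * ((\sum_j A i j) * x i 0).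
  rewrite !mxE mulrA mulr_sumr; congr (_ * _); apply: eq_bigr => j _.
  by rewrite mul_diag_mx mxE.
have tE i : p * (\sum_j (diag_mx d *m A) i j * psi j (x^T 0 j)) =
    d 0 i * (p * \sum_j A i j * psi j (x j 0)).
  rewrite mulrCA; congr (_ * _); rewrite mulr_sumr; apply: eq_bigr => j _.
  by rewrite mul_diag_mx !mxE mulrA.
split=> [/matrixP px i|px].
  rewrite sE tE; have := px i 0; rewrite vE mxE => /eqP; rewrite subr_eq0 => /eqP ->.
  by [].
apply/matrixP => i j; rewrite ord1 vE mxE; have := px i; rewrite sE tE.
by move=> /(mulfI (lt0r_neq0 (d_gt0 i))) ->; rewrite subrr.
Qed.

End Balance.

(** The equivalence expresses that the interval is the exact range away from its upper end: for
    [p <= 1] the signed equilibria are missing, and beyond [p2] a further equilibrium exists. *)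
Theorem lemma2 (R : realType) (n : nat) (A : 'M[R]_n) (psi : 'I_n -> R -> R)
  (n_gt1 : (1 < n)%N)
  (A_ge0 : forall i j, 0 <= A i j)
  (A_irreducible : irreducible_mx A)
  (A_symmetrizable : diag_symmetrizable A)
  (A_diag0 : forall i, A i i = 0)
  (psi_odd : forall i, odd_fun (psi i))
  (psi_monotone : forall i, monotone_fun (psi i))
  (psi_saturated : forall i, saturated (psi i))
  (psi_sigmoidal : forall i, sigmoidal (psi i)) :
  let p2 : \bar R := threshold (lambda_ n.-1 (H1 A)) in
  [/\ (1 < p2)%E,
      forall p : R, 1 < p ->
        (exists xp, nonneg_equilibrium A psi p xp) /\
        (exists xm, nonpos_equilibrium A psi p xm),
      forall p : R, 0 < p -> p%:E != p2 ->
        (no_extra_equilibrium A psi p <-> 1 < p /\ (p%:E < p2)%E) &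
      lambda_ 2 (L1 A) = 1 - lambda_ n.-1 (H1 A) /\
      p2 = threshold (1 - lambda_ 2 (L1 A))].
Proof.
move=> p2; have [d [d_gt0 ST]] := A_symmetrizable.
pose S := diag_mx d *m A; pose m := \row_i \sum_j S i j.
have SE i j : S i j = d 0 i * A i j by rewrite /S mul_diag_mx mxE.
have SC i j : S i j = S j i by rewrite /S -[in LHS]ST mxE.
have S_ge0 i j : 0 <= S i j by rewrite SE mulr_ge0// ltW.
have m_gt0 i : 0 < m 0 i.
  rewrite mxE; under eq_bigr do rewrite SE.
  by rewrite -mulr_sumr mulr_gt0// row_sum_gt0.
have S_edge (I : {set 'I_n}) : I != finset.set0 -> I != finset.setT ->
    exists i j, [/\ i \in I, j \notin I & 0 < S i j].
  move=> I0 IT; have [i [j [iI jI Aij]]] := irreducible_edge A_irreducible I0 IT.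
  by exists i, j; split=> //; rewrite SE mulr_gt0// lt_def Aij A_ge0.
have MH : diag_mx m *m H1 A = S by exact: weighted_H1.
pose ones : 'rV[R]_n := const_mx 1.
have ones0 : ones != 0.
  apply/eqP => /rowP/(_ (Ordinal n_gt1)); rewrite !mxE => /eqP.
  by rewrite oner_eq0.
have S1 : ones *m S = 1 *: (ones *m diag_mx m).
  apply/rowP => i; rewrite scale1r mul_mx_diag !mxE mul1r; apply: eq_bigr => j _.
  by rewrite mxE mul1r SC.
have o_gt0 : 0 < bform (diag_mx m) ones ones by rewrite dot_gt0.
pose c := Num.sqrt (bform (diag_mx m) ones ones).
have c_gt0 : 0 < c by rewrite sqrtr_gt0.
have u1 : bform (diag_mx m) (c^-1 *: ones) (c^-1 *: ones) = 1.
  rewrite bformZl bformZr mulrA -invfM -expr2 sqr_sqrtr ?ltW//.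
  by rewrite mulVf// gt_eqF.
have u1S : c^-1 *: ones *m S = 1 *: (c^-1 *: ones *m diag_mx m).
  by rewrite -!scalemxAl S1 !scale1r.
have [e [l [[e0 l0] ee eS [eigH eigL] expand]]] := eigenbasis ST m_gt0 MH u1 u1S.
have n_gt0 : (0 < n)%N by exact: ltnW.
have e_ones i : (0 < i < n)%N -> bform (diag_mx m) (e i) ones = 0.
  move=> /andP[i0 ilt]; have := ee i 0%N ilt n_gt0.
  rewrite gtn_eqF// e0 bformZr => /eqP.
  by rewrite mulf_eq0 invr_eq0 (gt_eqF c_gt0) => /eqP.
have e_neq0 i : (i < n)%N -> e i != 0.
  by move=> ilt; rewrite -(dot_gt0 m_gt0) ee// eqxx ltr01.
have l_lt1 i : (0 < i < n)%N -> l i < 1.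
  move=> i0n; have /andP[_ ilt] := i0n.
  exact: (eigenvalue_lt1 ST S_ge0 m_gt0 S_edge (eS i ilt) (e_neq0 i ilt) (e_ones i i0n)).
have [|k [k0n kE l_le]] := @sort_second_largest R n l n_gt1.
  by move=> i /l_lt1/ltW; rewrite l0.
have lamE : lambda_ n.-1 (H1 A) = l k by rewrite /lambda_ eigH kE.
have /andP[_ klt] := k0n.
(* [eigL] lists the spectrum of [L1 A] backwards, so index 1 there corresponds to index [n.-2] for
   [H1 A]. *)
have lam2E : lambda_ 2 (L1 A) = 1 - l k.
  have sz : size (eigenvalues (H1 A)) = n by rewrite eigH size_sort size_map size_iota.
  rewrite /lambda_ /L1 eigL nth_rev ?size_map ?sz// (nth_map 0) ?sz; last first.
    by rewrite ltn_subrL.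
  by rewrite eigH -kE; congr (1 - nth _ _ _); case: (n) n_gt1 => [|[|?]]//; rewrite subn2.
have steady_eq p x : equilibrium A psi p x <-> steady S psi p x^T.
  exact: equilibriumE.
have eqN p x : equilibrium A psi p x -> equilibrium A psi p (- x).
  by move=> /steady_eq px; apply/steady_eq; rewrite linearN/=; exact: steadyN.
have tr_neq0 (x : 'cV[R]_n) : x != 0 -> x^T != 0 by rewrite trmx_eq0.
have exists_pos p : 1 < p -> exists xp : 'cV[R]_n,
    [/\ equilibrium A psi p xp, xp != 0 & forall i, 0 < xp i 0].
  move=> p1; have [x px x0] :=
    steady_exists S_ge0 m_gt0 psi_odd psi_monotone psi_saturated p1.
  exists x^T; split; first by apply/steady_eq; rewrite trmxK.
    apply/eqP => /matrixP/(_ (Ordinal n_gt1) 0); rewrite !mxE.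
    by apply/eqP; rewrite gt_eqF.
  by move=> i; rewrite mxE.
have nonposN p x : nonneg_equilibrium A psi p x -> nonpos_equilibrium A psi p (- x).
  move=> [px x0 x_ge0]; split; [exact: eqN|by rewrite oppr_eq0|].
  by move=> i; rewrite mxE oppr_le0.
split.
- rewrite /p2 lamE lt_threshold ?ltr01// mul1r; exact: l_lt1.
- move=> p /exists_pos[xp [px x0 x_gt0]].
  have xp_ge0 : nonneg_equilibrium A psi p xp by split=> // i; rewrite ltW.
  by split; [exists xp|exists (- xp); exact: nonposN].
- move=> p p0; rewrite /p2 lamE => pp2; rewrite lt_threshold//.
  have {pp2}pl1 := neq_threshold p0 pp2.
  split=> [[xp [xm [[px x0 x_ge0] [qm m0 m_le0] only]]]|[p1 pl]].
    split.
      rewrite ltNge; apply/negP => p1; move: (tr_neq0 _ x0) => /eqP; apply.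
      apply: (steady_small S_ge0 m_gt0 psi_odd psi_monotone psi_sigmoidal (p := p)).
        by rewrite p0.
      exact/steady_eq.
    rewrite ltNge le_eqVlt eq_sym (negbTE pl1)/=; apply/negP => pl.
    (* [- xp] is an equilibrium other than 0 and [xp], so the equilibria have the form 0, a, -a
       refuted by [extra_equilibrium]. *)
    have xmE : xm = - xp.
      have [E|E|->//] := only _ (eqN _ _ px).
        by case/eqP: x0; rewrite -[xp]opprK E oppr0.
      case/eqP: x0; apply/matrixP => i j; have /matrixP/(_ i j) := E.
      by rewrite !mxE; lra.
    apply: (extra_equilibrium ST S_ge0 m_gt0 psi_odd psi_monotone psi_saturated
      psi_sigmoidal p0 (eS k klt) (e_neq0 k klt) (e_ones k k0n) (ltW (l_lt1 k k0n)) pl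
      (tr_neq0 _ x0)) => x px'.
    have [] := only x^T; first by apply/steady_eq; rewrite trmxK.
    + by move=> E; apply: Or31; rewrite -[x]trmxK E trmx0.
    + by move=> E; apply: Or32; rewrite -[x]trmxK E.
    + by move=> E; apply: Or33; rewrite -[x]trmxK E xmE linearN.
  have [xp [px x0 x_gt0]] := exists_pos _ p1.
  have xp_ge0 : nonneg_equilibrium A psi p xp by split=> // i; rewrite ltW.
  exists xp, (- xp); split=> //; first exact: nonposN.
  have pos_eq x : equilibrium A psi p x -> x != 0 -> (forall i, 0 <= x i 0) -> x = xp.
    move=> qx xn0 x_ge0; apply: trmx_inj.
    have/steady_eq sx := qx; have/steady_eq sp := px.
    apply: (steady_pos_unique S_ge0 m_gt0 psi_odd psi_monotone psi_sigmoidal p0 sx sp).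
      apply: (steady_gt0 S_ge0 S_edge psi_odd psi_monotone p0 sx (tr_neq0 _ xn0)).
      by move=> i; rewrite mxE.
    by move=> i; rewrite mxE.
  move=> x qx; have [->|xn0] := eqVneq x 0; first exact: Or31.
  have [x_ge0|/existsNP[j /negP]] := pselect (forall i, 0 <= x i 0).
    by apply: Or32; exact: pos_eq.
  have [x_le0 _|/existsNP[i /negP]] := pselect (forall i, x i 0 <= 0).
    apply: Or33; rewrite -[x]opprK (pos_eq (- x))//; [exact: eqN|by rewrite oppr_eq0|].
    by move=> i; rewrite mxE oppr_ge0.
  rewrite -!ltNge => xi xj; exfalso; have/steady_eq sx := qx.
  have [||w w1] := steady_sign_change ST S_ge0 m_gt0 psi_odd psi_monotone psi_sigmoidal
    p0 sx (i0 := i) (j0 := j); rewrite ?mxE//.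
  (* In the eigenbasis [w] has no component along [e 0], and p l_a <= p l_k < 1 on the others, so p
     S(w, w) cannot exceed the squared norm. *)
  have [-> ->] := expand w; rewrite ltNge => /negP; apply.
  rewrite mulr_sumr; apply: ler_sum => a _.
  have [a0|a_gt0] := posnP a.
    by rewrite a0 e0 bformZr w1 mulr0 expr0n/= !mulr0.
  rewrite mulrA ler_piMl ?sqr_ge0//; apply: le_trans (ltW pl).
  by rewrite ler_pM2l// l_le// a_gt0 ltn_ord.
- by rewrite lam2E /p2 lamE subKr.
Qed.
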